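(* Let $\mathcal C=\mathbb R^2\times[0,\infty)$ and $\vartheta_b=(\alpha_0^{\top},0)^{\top}$ with $\alpha_0\in\mathbb R^2$. Let $\Theta_b\subset\mathbb R^2\times[0,\infty)$ be compact with $\vartheta_b+\{\mathcal C\cap B(0,\varrho)\}\subset\Theta_b$ for some $\varrho>0$. Write $\vartheta=(\alpha^{\top},\psi)^{\top}$. Let $Y_n$ be random vectors in $\mathbb R^5$, $W_n$ random matrices, and $\mu_n,\mu,\widetilde\mu_n:\Theta_b\to\mathbb R^5$ deterministic maps, and let $G=(G_\alpha,g_\psi)$ be a $5\times3$ matrix ($G_\alpha$: first two columns). Assume: (B1) $Z_n=\sqrt n\{Y_n-\mu_n(\vartheta_b)\}\Rightarrow N(0,\Omega)$ with $\Omega\succ0$, and $W_n\to_p\Omega^{-1}$ with $W_n$ positive definite; (B2) $\sup_{\Theta_b}\|\mu_n-\mu\|\to0$, $\mu$ is continuous on $\Theta_b$, and $\mu(\vartheta)=\mu(\vartheta_b)$ has the unique solution $\vartheta_b$ on $\Theta_b$; (B3) $$\lim_{r\downarrow0}\limsup_{n\to\infty}\sup_{\substack{\vartheta\in\Theta_b\\0<\|\vartheta-\vartheta_b\|\le r}}\frac{\|\mu_n(\vartheta)-\mu_n(\vartheta_b)-G(\vartheta-\vartheta_b)\|}{\|\vartheta-\vartheta_b\|}=0,$$ and $\sqrt n\sup_{\Theta_b}\|\widetilde\mu_n-\mu_n\|\to0$; (B4) $G_\alpha$ has full column rank and $I_{\mathrm{eff}}>0$. Define $Q_n(\alpha,\psi)=\{Y_n-\widetilde\mu_n(\alpha,\psi)\}^{\top}W_n\{Y_n-\widetilde\mu_n(\alpha,\psi)\}$,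 and let $(\widehat\alpha,\widehat\psi)\in\Theta_b$ and $(\widehat\alpha_0,0)\in\Theta_b$ be measurable random elements satisfying, for some $r_{1n},r_{0n}\ge0$ with $n(r_{1n}+r_{0n})\to_p0$, $$Q_n(\widehat\alpha,\widehat\psi)\le\inf_{\Theta_b}Q_n+r_{1n},\qquad Q_n(\widehat\alpha_0,0)\le\inf_{\alpha:(\alpha,0)\in\Theta_b}Q_n(\alpha,0)+r_{0n}.$$ Then both estimators are consistent and root-$n$ localized (i.e. $\sqrt n\|(\widehat\alpha,\widehat\psi)-\vartheta_b\|=O_p(1)$ and $\sqrt n\|(\widehat\alpha_0,0)-\vartheta_b\|=O_p(1)$), $$\sqrt n\,\widehat\psi\Rightarrow\max\left(0,\frac{\Delta}{I_{\mathrm{eff}}}\right),\qquad \Delta=r_\psi^{\top}\Omega^{-1}Z\sim N(0,I_{\mathrm{eff}}),\quad Z\sim N(0,\Omega),$$ for $\widehat b=\sqrt{\widehat\psi}$, $n^{1/4}\widehat b\Rightarrow\{\max(0,\Delta/I_{\mathrm{eff}})\}^{1/2}$, and $$D_n=n\Bigl\{\inf_{\alpha:(\alpha,0)\in\Theta_b}Q_n(\alpha,0)-\inf_{(\alpha,\psi)\in\Theta_b}Q_n(\alpha,\psi)\Bigr\}\Rightarrow\{\max(0,N(0,1))\}^2\sim\tfrac12\chi^2_0+\tfrac12\chi^2_1 .$$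
   Context: When $G_\alpha$ has full column rank, $P_\alpha=G_\alpha(G_\alpha^{\top}\Omega^{-1}G_\alpha)^{-1}G_\alpha^{\top}\Omega^{-1}$, $r_\psi=(I-P_\alpha)g_\psi$, $I_{\mathrm{eff}}=r_\psi^{\top}\Omega^{-1}r_\psi$. $B(0,\varrho)$ is the Euclidean ball. $\chi^2_0$ is the point mass at $0$ and $\frac12\chi^2_0+\frac12\chi^2_1$ is the equal mixture. In the paper $Y_n$ is the vector of five normalized motif counts of a random graph of size $n$ with mean $\mu_n$ and limiting mean $\mu$, but the theorem uses only the listed conditions. *)

(* Defs.v *)
From HB Require Import structures.
From mathcomp Require Export all_boot all_order all_algebra.
From mathcomp Require Export all_classical all_reals all_analysis.

Set Implicit Arguments.
Unset Strict Implicit.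
Unset Printing Implicit Defensive.

Export Order.TTheory GRing.Theory Num.Theory.
Export numFieldNormedType.Exports.

Local Open Scope classical_set_scope.
Local Open Scope ring_scope.

(* Measurability with respect to the Borel sigma-algebra of S. *)
Definition random_element d (T : measurableType d) (S : ptopologicalType)
    (X : T -> S) : Prop :=
  measurable_fun [set: T] (X : T -> g_sigma_algebraType (@open S)).

(* In this and the next two definitions, the n-th term of the sequence lives on
   its own probability space (T n, P n). *)
Definition cvg_in_law (R : realType) (S : ptopologicalType)
    (d : nat -> measure_display) (T : forall n, measurableType (d n))
    (P : forall n, probability (T n) R) (X : forall n, T n -> S)
    (d' : measure_display) (T' : measurableType d')
    (P' : probability T' R) (Z : T' -> S) : Prop :=
  [/\ forall n, random_element (X n),
      random_element Z &
      forall f : S -> R, continuous f -> bounded_fun f ->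
        'E_(P n)[f \o X n]%E @[n --> \oo] --> 'E_P'[f \o Z]%E].

Definition cvg_in_prob (R : realType) (V : normedModType R)
    (d : nat -> measure_display) (T : forall n, measurableType (d n))
    (P : forall n, probability (T n) R) (X : forall n, T n -> V) (c : V) :
    Prop :=
  forall e : R, 0 < e ->
    P n [set w | e <= `|X n w - c|] @[n --> \oo] --> 0%E.

Definition bigO_in_prob1 (R : realType)
    (d : nat -> measure_display) (T : forall n, measurableType (d n))
    (P : forall n, probability (T n) R) (X : forall n, T n -> R) : Prop :=
  forall e : R, 0 < e -> exists M : R,
    \forall n \near \oo, (P n [set w | (M < `|X n w|)%R] <= e%:E)%E.

Definition has_law (R : realType) d (T : measurableType d)
    (P : probability T R) (X : T -> R) (L : set R -> \bar R) : Prop :=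
  measurable_fun [set: T] X /\
  forall A : set R, measurable A -> P (X @^-1` A) = L A.

(* [normal_prob] takes the standard deviation and is not a point mass when it
   is 0, hence the case distinction. *)
Definition normal_law (R : realType) (m v : R) : set R -> \bar R :=
  if v == 0 then \d_m else normal_prob m (Num.sqrt v).

(* Z ~ N(m, Sigma): every linear combination of the coordinates of Z is
   univariate normal, with the mean and variance prescribed by m and Sigma. *)
Definition normal_vector (R : realType) d (T : measurableType d)
    (P : probability T R) k (Z : T -> 'cV[R]_k) (m : 'cV[R]_k)
    (Sigma : 'M[R]_k) : Prop :=
  forall a : 'cV[R]_k,
    has_law P (fun w => (a^T *m Z w) 0 0)
      (normal_law ((a^T *m m) 0 0) ((a^T *m Sigma *m a) 0 0)).

(* The k-th chi-square law is that of the sum of the squares of k independent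
   standard normals. *)
Definition chisq0 (R : realType) : set R -> \bar R := \d_(0 : R).

Definition chisq1 (R : realType) : set R -> \bar R :=
  pushforward (normal_prob (0 : R) 1) (fun x : R => x ^+ 2).

Definition half_chisq01 (R : realType) (A : set R) : \bar R :=
  ((2^-1)%:E * chisq0 A + (2^-1)%:E * chisq1 A)%E.

(* Euclidean norm; the library norm `|v| of a matrix is the sup norm. *)
Definition enorm (R : realType) k (v : 'cV[R]_k) : R :=
  Num.sqrt (\sum_(i < k) v i 0 ^+ 2).

Definition posdefmx (R : realType) k (A : 'M[R]_k) : Prop :=
  A^T = A /\ forall x : 'cV[R]_k, x != 0 -> 0 < (x^T *m A *m x) 0 0.

Section efficient_information.
Context (R : realType) (k : nat).
Variables (Omega : 'M[R]_k) (G : 'M[R]_(k, 2 + 1)).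

Definition Galpha : 'M[R]_(k, 2) := lsubmx G.
Definition gpsi : 'cV[R]_k := rsubmx G.

Definition Palpha : 'M[R]_k :=
  Galpha *m invmx (Galpha^T *m invmx Omega *m Galpha) *m Galpha^T
    *m invmx Omega.

Definition rpsi : 'cV[R]_k := (1%:M - Palpha) *m gpsi.

Definition Ieff : R := (rpsi^T *m invmx Omega *m rpsi) 0 0.

Definition Delta (z : 'cV[R]_k) : R := (rpsi^T *m invmx Omega *m z) 0 0.

End efficient_information.

Definition param (R : realType) (alpha : 'cV[R]_2) (psi : R) : 'cV[R]_(2 + 1) :=
  col_mx alpha psi%:M.

Definition cone (R : realType) : set 'cV[R]_(2 + 1) :=
  [set h | exists alpha psi, 0 <= psi /\ h = param alpha psi].
Arguments cone R : clear implicits.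

Section criterion.
Context (R : realType) (k : nat).
Variables (Theta : set 'cV[R]_(2 + 1)) (mut : 'cV[R]_(2 + 1) -> 'cV[R]_k).
Variables (y : 'cV[R]_k) (W : 'M[R]_k).

Definition Qcrit (alpha : 'cV[R]_2) (psi : R) : R :=
  ((y - mut (param alpha psi))^T *m W *m (y - mut (param alpha psi))) 0 0.

Definition infQ : R :=
  inf [set q | exists alpha psi, Theta (param alpha psi) /\ q = Qcrit alpha psi].

Definition infQ0 : R :=
  inf [set q | exists alpha, Theta (param alpha 0) /\ q = Qcrit alpha 0].

End criterion.

(* Main.v *)
From HB Require Import structures.
Require Import Defs.
From mathcomp Require Import measurable_realfun ring lra.

Set Implicit Arguments.
Unset Strict Implicit.
Unset Printing Implicit Defensive.

Local Open Scope classical_set_scope.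
Local Open Scope ring_scope.

(** Let [Zn = sqrt n (Y_n - mu_n thetab)] and let [h = sqrt n (theta - thetab)]
    be the local parameter. Linearizing the mean shows that the rescaled
    criterion [n Q_n] equals [qform (invmx Omega) (Zn - G h)] up to [o(1)] when
    [h] stays bounded. Since [Theta] coincides with [thetab + cone] near
    [thetab], the problem becomes that of projecting [Zn] onto the image of the
    cone. Splitting the residual orthogonally along the span of [Galpha]
    ([qform_residual]) eliminates [alpha] and leaves the minimization of
    [I b ^ 2 - 2 b Delta(Zn)] over [b >= 0]. Its solution is
    [bstar = max (0, Delta(Zn) / I)], with value [- I bstar ^ 2], and the null
    constraint [b = 0] gives the value 0. Thus [sqrt n psihat] is close to
    [bstar] and [D_n] to [I bstar ^ 2].

    The argument has a deterministic and a probabilistic half. The expansion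
    above is proved along an arbitrary filter in which [n] tends to infinity,
    [Zn] is bounded, [W_n] tends to [invmx Omega] and the tolerance of the
    minimization vanishes ([near_minimizer_local] for the rate,
    [near_minimizer_expansion] for the values). Now [Zn] is tight because it
    converges in law, and the other two conditions hold in probability; so what
    holds along each filter [good_filter M] holds with probability close to one
    ([good_filter_prob]). The limit laws follow from the continuous mapping
    principle and Slutsky's lemma ([cvg_in_law_comp], [cvg_in_law_slutsky]).

    Two facts complete the proof: [Delta / sqrt I] is standard normal, and the
    symmetry of that law makes the square of its positive part the equal mixture
    ([has_law_max0_sqr]); the infima of the criterion are measurable although
    they range over an uncountable set ([measurable_exists_lt]). *)

(** * Norms of matrices and quadratic forms *)

Section matrix_norms.
Context (R : realType).

Lemma entry_le_mxnorm m n (A : 'M[R]_(m, n)) i j : `|A i j| <= `|A|.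
Proof.
by rewrite [leRHS]/Num.Def.normr/= mx_normrE; exact: (le_bigmax _ _ (i, j)).
Qed.

Lemma mxnorm_le m n (A : 'M[R]_(m, n)) c :
  0 <= c -> (forall i j, `|A i j| <= c) -> `|A| <= c.
Proof.
move=> c0 Ac; rewrite [leLHS]/Num.Def.normr/= mx_normrE.
by apply: bigmax_le => // -[i j] _; exact: Ac.
Qed.

Lemma mxnorm_mul m n p (A : 'M[R]_(m, n)) (B : 'M[R]_(n, p)) :
  `|A *m B| <= n%:R * `|A| * `|B|.
Proof.
apply: mxnorm_le => [|i j]; first by rewrite !mulr_ge0.
rewrite mxE (le_trans (ler_norm_sum _ _ _))//.
rewrite (@le_trans _ _ (\sum_(l < n) `|A| * `|B|))//.
  by apply: ler_sum => l _; rewrite normrM ler_pM// entry_le_mxnorm.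
by rewrite sumr_const card_ord -[leLHS]mulr_natl mulrA.
Qed.

Lemma mxnorm_tr m n (A : 'M[R]_(m, n)) : `|A^T| <= `|A|.
Proof. by apply: mxnorm_le => // i j; rewrite mxE entry_le_mxnorm. Qed.

Lemma mxnorm_le_enorm k (v : 'cV[R]_k) : `|v| <= enorm v.
Proof.
apply: mxnorm_le => [|i j]; first exact: sqrtr_ge0.
rewrite ord1 -sqrtr_sqr ler_sqrt; last by apply: sumr_ge0 => l _; exact: sqr_ge0.
by rewrite (bigD1 i)//= lerDl; apply: sumr_ge0 => l _; exact: sqr_ge0.
Qed.

Lemma enorm_le_mxnorm k (v : 'cV[R]_k) : enorm v <= k%:R * `|v|.
Proof.
have kv0 : 0 <= k%:R * `|v| by rewrite mulr_ge0.
rewrite -[leRHS](ger0_norm kv0) -sqrtr_sqr ler_sqrt ?sqr_ge0//.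
rewrite (@le_trans _ _ (\sum_(i < k) `|v| ^+ 2))//.
  apply: ler_sum => i _; rewrite -[leLHS]real_normK ?num_real//.
  by rewrite ler_pXn2r ?nnegrE ?entry_le_mxnorm.
rewrite sumr_const card_ord exprMn -[leLHS]mulr_natl ler_wpM2r ?sqr_ge0//.
by rewrite -natrX ler_nat; case: k {v kv0} => // k; rewrite leq_pmulr.
Qed.

End matrix_norms.

Section quadratic_forms.
Context (R : realType).

Definition bform k (W : 'M[R]_k) (u v : 'cV[R]_k) : R := (u^T *m W *m v) 0 0.

Definition qform k (W : 'M[R]_k) (v : 'cV[R]_k) : R := bform W v v.

Lemma bformDl k (W : 'M[R]_k) u1 u2 v :
  bform W (u1 + u2) v = bform W u1 v + bform W u2 v.
Proof. by rewrite /bform linearD/= !mulmxDl mxE. Qed.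

Lemma bformDr k (W : 'M[R]_k) u v1 v2 :
  bform W u (v1 + v2) = bform W u v1 + bform W u v2.
Proof. by rewrite /bform mulmxDr mxE. Qed.

Lemma bformZl k (W : 'M[R]_k) a u v : bform W (a *: u) v = a * bform W u v.
Proof. by rewrite /bform linearZ/= -!scalemxAl mxE. Qed.

Lemma bformZr k (W : 'M[R]_k) a u v : bform W u (a *: v) = a * bform W u v.
Proof. by rewrite /bform -!scalemxAr mxE. Qed.

Lemma bformNl k (W : 'M[R]_k) u v : bform W (- u) v = - bform W u v.
Proof. by rewrite -scaleN1r bformZl mulN1r. Qed.

Lemma bformNr k (W : 'M[R]_k) u v : bform W u (- v) = - bform W u v.
Proof. by rewrite -scaleN1r bformZr mulN1r. Qed.

Lemma bformC k (W : 'M[R]_k) u v : W^T = W -> bform W u v = bform W v u.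
Proof.
move=> WT; rewrite /bform -[in LHS](trmxK (_ *m v)) [LHS]mxE.
by rewrite !trmx_mul trmxK WT mulmxA.
Qed.

Lemma bformDm k (W1 W2 : 'M[R]_k) u v :
  bform (W1 + W2) u v = bform W1 u v + bform W2 u v.
Proof. by rewrite /bform mulmxDr mulmxDl mxE. Qed.

Lemma qformZ k (W : 'M[R]_k) a v : qform W (a *: v) = a ^+ 2 * qform W v.
Proof. by rewrite /qform bformZl bformZr mulrA -expr2. Qed.

Lemma qformN k (W : 'M[R]_k) v : qform W (- v) = qform W v.
Proof. by rewrite /qform bformNl bformNr opprK. Qed.

Lemma qformD k (W : 'M[R]_k) u v : W^T = W ->
  qform W (u + v) = qform W u + 2 * bform W u v + qform W v.
Proof.
by move=> WT; rewrite /qform bformDl !bformDr (bformC v u WT); ring.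
Qed.

Lemma norm_bform_le k (W : 'M[R]_k) u v :
  `|bform W u v| <= k%:R ^+ 2 * `|W| * `|u| * `|v|.
Proof.
rewrite (le_trans (entry_le_mxnorm _ _ _))// (le_trans (mxnorm_mul _ _))//.
rewrite ler_wpM2r// (le_trans (ler_wpM2l _ (mxnorm_mul _ _)))//.
have -> : k%:R * (k%:R * `|u^T| * `|W|) = k%:R ^+ 2 * `|W| * `|u^T| :> R by ring.
by rewrite ler_wpM2l ?mxnorm_tr// mulr_ge0 ?sqr_ge0.
Qed.

Lemma posdefmx_unit k (A : 'M[R]_k) : posdefmx A -> A \in unitmx.
Proof.
move=> [_ Apos]; rewrite -row_free_unit -kermx_eq0.
apply/eqP/row_matrixP => i; rewrite row0.
apply/eqP/negP => /negP ri0.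
have /Apos : (row i (kermx A))^T != 0.
  by apply: contra ri0 => /eqP h; rewrite -(trmxK (row _ _)) h trmx0.
by rewrite trmxK -row_mul mulmx_ker row0 mul0mx mxE ltxx.
Qed.

Lemma posdefmx_inv k (A : 'M[R]_k) : posdefmx A -> posdefmx (invmx A).
Proof.
move=> Apd; have Au := posdefmx_unit Apd; case: Apd => AT Apos; split.
  by rewrite trmx_inv AT.
move=> x x0; have -> : x = A *m (invmx A *m x) by rewrite mulKVmx.
rewrite trmx_mul AT -!mulmxA mulKmx// mulmxA; apply: Apos.
by apply: contra x0 => /eqP h; rewrite -(mulKVmx Au x) h mulmx0.
Qed.

Lemma qform_ge0 k (W : 'M[R]_k) v : posdefmx W -> 0 <= qform W v.
Proof.
move=> [_ Wpos]; have [->|/Wpos/ltW//] := eqVneq v 0.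
by rewrite /qform /bform mulmx0 mxE.
Qed.

(** Each coordinate of [v] is the [W]-inner product of [v] with a column of the
    inverse of [W], so that Cauchy-Schwarz bounds it by the form. *)
Lemma posdefmx_coercive k (W : 'M[R]_k) : posdefmx W ->
  exists2 c : R, 0 < c & forall v, c * `|v| ^+ 2 <= qform W v.
Proof.
move=> Wpd; have Wu := posdefmx_unit Wpd; have WT := Wpd.1.
pose e i : 'cV[R]_k := invmx W *m delta_mx i 0.
have eE i v : bform W (e i) v = v i 0.
  rewrite /bform /e trmx_mul trmx_inv WT -!mulmxA mulKmx// trmx_delta.
  by rewrite -rowE mxE.
pose K := 1 + \sum_i qform W (e i).
have qe0 i : 0 <= qform W (e i) by exact: qform_ge0.
have K0 : 0 < K by rewrite ltr_pwDl// sumr_ge0.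
have qeK i : qform W (e i) <= K.
  by rewrite /K (bigD1 i)//= addrCA lerDl addr_ge0// sumr_ge0.
exists K^-1; first by rewrite invr_gt0.
move=> v; rewrite ler_pdivrMl//.
have coord i : v i 0 ^+ 2 <= K * qform W v.
  have := qform_ge0 (v + (- (v i 0 / K)) *: e i) Wpd.
  rewrite qformD// bformZr (bformC _ _ WT) eE qformZ.
  have Hle : (- (v i 0 / K)) ^+ 2 * qform W (e i) <= (v i 0 / K) ^+ 2 * K.
    by rewrite sqrrN ler_wpM2l ?sqr_ge0.
  move=> H0.
  have {Hle} H1 := le_trans H0 (lerD (lexx _) Hle).
  have -> : v i 0 ^+ 2 = K * (2 * ((v i 0 / K) * v i 0) - (v i 0 / K) ^+ 2 * K).
    by field; rewrite gt_eqF.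
  rewrite ler_pM2l// -subr_ge0; apply: le_trans H1 _; lra.
have KQ0 : 0 <= K * qform W v by apply: mulr_ge0; [exact: ltW|exact: qform_ge0].
rewrite -[leRHS](sqr_sqrtr KQ0) ler_sqr ?nnegrE ?sqrtr_ge0//.
apply: mxnorm_le => [|i j]; first exact: sqrtr_ge0.
by rewrite ord1 -sqrtr_sqr ler_sqrt.
Qed.

End quadratic_forms.

(** * The limiting cone-constrained least-squares problem *)

Section param_facts.
Context (R : realType).

Lemma paramE (h : 'cV[R]_(2 + 1)) : h = param (usubmx h) (dsubmx h 0 0).
Proof. by rewrite /param -mx11_scalar vsubmxK. Qed.

Lemma param_psi (a : 'cV[R]_2) (b : R) : dsubmx (param a b) 0 0 = b.
Proof. by rewrite /param col_mxKd mxE eqxx mulr1n. Qed.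

Lemma paramB (a1 a2 : 'cV[R]_2) (b1 b2 : R) :
  param a1 b1 - param a2 b2 = param (a1 - a2) (b1 - b2).
Proof. by rewrite /param opp_col_mx add_col_mx raddfB. Qed.

Lemma paramD (a1 a2 : 'cV[R]_2) (b1 b2 : R) :
  param a1 b1 + param a2 b2 = param (a1 + a2) (b1 + b2).
Proof. by rewrite /param add_col_mx raddfD. Qed.

Lemma paramZ (c : R) (a : 'cV[R]_2) (b : R) :
  c *: param a b = param (c *: a) (c * b).
Proof. by rewrite /param scale_col_mx scale_scalar_mx. Qed.

Lemma cone_param (a : 'cV[R]_2) (b : R) : cone R (param a b) -> 0 <= b.
Proof.
move=> [a' [b' [b'0 /(congr1 (fun h : 'cV[R]_(2 + 1) => dsubmx h 0 0))]]].
by rewrite !param_psi => ->.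
Qed.

Lemma mxnorm_param (a : 'cV[R]_2) (b : R) : `|param a b| <= `|a| + `|b|.
Proof.
apply: mxnorm_le => [|i j]; first by rewrite addr_ge0.
rewrite /param !mxE; case: splitP => l _.
  by rewrite (le_trans (entry_le_mxnorm _ _ _))// lerDl.
by rewrite mxE !ord1 eqxx mulr1n lerDr.
Qed.

End param_facts.

Section limit_problem.
Context (R : realType) (k : nat) (Omega : 'M[R]_k) (G : 'M[R]_(k, 2 + 1)).

Local Notation V := (invmx Omega).
Local Notation Ga := (Galpha G).
Local Notation g := (gpsi G).
Local Notation r := (rpsi Omega G).
Local Notation I := (Ieff Omega G).
Local Notation Dl := (Delta Omega G).

Lemma mulG_param a b : G *m param a b = Ga *m a + b *: g.
Proof.
by rewrite -{1}(hsubmxK G) /param mul_row_col mul_mx_scalar.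
Qed.

(** Coefficients of the weighted least-squares regression on [Galpha]. *)
Definition Lalpha : 'M[R]_(2, k) := invmx (Ga^T *m V *m Ga) *m Ga^T *m V.
Local Notation L := Lalpha.

(** Minimum over [a] of the criterion at [b = 0]. *)
Definition profile (z : 'cV[R]_k) : R := qform V (z - Ga *m (L *m z)).

Definition bstar (z : 'cV[R]_k) : R := Num.max 0 (Dl z / I).

Definition hstar (z : 'cV[R]_k) : 'cV[R]_(2 + 1) :=
  param (L *m z - bstar z *: (L *m g)) (bstar z).

Definition h0star (z : 'cV[R]_k) : 'cV[R]_(2 + 1) := param (L *m z) 0.

Hypothesis Omega_pd : posdefmx Omega.
Hypothesis Ga_rank : \rank Ga = 2%N.
Hypothesis I_gt0 : 0 < I.

Let Vpd : posdefmx V. Proof. exact: posdefmx_inv. Qed.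
Let VT : V^T = V. Proof. by case: Vpd. Qed.

Lemma gram_unit : Ga^T *m V *m Ga \in unitmx.
Proof.
apply: posdefmx_unit; split; first by rewrite !trmx_mul trmxK VT mulmxA.
move=> x x0.
have -> : x^T *m (Ga^T *m V *m Ga) *m x = (Ga *m x)^T *m V *m (Ga *m x).
  by rewrite trmx_mul !mulmxA.
apply: Vpd.2; apply: contra x0 => /eqP /(congr1 trmx).
rewrite trmx_mul trmx0 => xG.
have : row_free Ga^T by rewrite /row_free mxrank_tr Ga_rank.
move=> /row_free_inj inj; have /inj xT : x^T *m Ga^T = 0 *m Ga^T.
  by rewrite mul0mx.
by rewrite -(trmxK x) xT trmx0.
Qed.

Lemma Lalpha_mul : L *m Ga = 1%:M.
Proof. by rewrite /Lalpha -!mulmxA mulVmx// !mulmxA gram_unit. Qed.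

(** [Galpha *m Lalpha] is the orthogonal projection onto the span of [Galpha]
    for the inner product [invmx Omega]. *)
Lemma orth_Galpha x a : bform V (x - Ga *m (L *m x)) (Ga *m a) = 0.
Proof.
rewrite bformC// /bform trmx_mul.
have gramL : Ga^T *m V *m Ga *m (L *m x) = Ga^T *m V *m x.
  by rewrite /Lalpha -!(mulmxA (invmx (_ *m _))) mulKVmx ?gram_unit// !mulmxA.
have -> : a^T *m Ga^T *m V *m (x - Ga *m (L *m x)) =
    a^T *m (Ga^T *m V *m x - Ga^T *m V *m Ga *m (L *m x)).
  by rewrite !mulmxBr !mulmxA.
by rewrite gramL subrr mulmx0 mxE.
Qed.

Lemma rpsiE : r = g - Ga *m (L *m g).
Proof. by rewrite /rpsi mulmxBl mul1mx /Palpha /Lalpha !mulmxA. Qed.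

Lemma rpsi_orth a : bform V r (Ga *m a) = 0.
Proof. by rewrite rpsiE orth_Galpha. Qed.

(** Orthogonal decomposition of the residual with respect to [V]: the component
    in the span of [Galpha] is free, since [a] is, and [rpsi] carries the rest
    of the dependence on [b]. *)
Lemma qform_residual z a b :
  qform V (z - G *m param a b) =
  profile z + qform V (Ga *m (a - (L *m z - b *: (L *m g))))
    + (I * b ^+ 2 - 2 * b * Dl z).
Proof.
have -> : z - G *m param a b =
    ((z - Ga *m (L *m z)) + (- b) *: r)
      + Ga *m (- (a - (L *m z - b *: (L *m g)))).
  rewrite mulG_param rpsiE mulmxN !mulmxBr -scalemxAr.
  by rewrite scalerBr !scaleNr; apply/matrixP => i j; rewrite !mxE; ring.
rewrite qformD// bformDl orth_Galpha bformZl rpsi_orth mulr0 addr0 mulr0 addr0.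
rewrite qformD// qformZ bformZr -/(profile z).
have -> : bform V (z - Ga *m (L *m z)) r = Dl z.
  by rewrite bformC// bformDr -mulmxN rpsi_orth addr0.
have -> : qform V r = I by [].
by rewrite mulmxN qformN; ring.
Qed.

(** The inner product with [rpsi] reads off [b], because [rpsi] is orthogonal to
    the span of [Galpha] and nonzero; regression on [Galpha] then reads off [a]. *)
Lemma G_left_inverse : exists A : 'M[R]_(2 + 1, k), A *m G = 1%:M.
Proof.
pose v := I^-1 *: (r^T *m V).
have vGa : v *m Ga = 0.
  apply/rowP => j; rewrite [RHS]mxE /v -scalemxAl mxE.
  have := rpsi_orth (delta_mx j 0); rewrite /bform mulmxA mxE.
  rewrite (bigD1 j)//= big1 ?addr0; last first.
    by move=> i /negPf ij; rewrite [delta_mx _ _ _ _]mxE ij mulr0.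
  by rewrite [delta_mx _ _ _ _]mxE !eqxx mulr1 => ->; rewrite mulr0.
have vg : v *m g = 1%:M.
  have -> : g = r + Ga *m (L *m g) by rewrite rpsiE subrK.
  rewrite mulmxDr (mulmxA v Ga) vGa mul0mx addr0 /v -scalemxAl.
  rewrite [_ *m r]mx11_scalar scale_scalar_mx -/(Ieff Omega G).
  by rewrite mulVf// gt_eqF.
exists (col_mx (L - L *m g *m v) v).
rewrite -[X in _ *m X]hsubmxK -/Ga -/g mul_col_row.
rewrite !mulmxBl -!(mulmxA (L *m g) v) vGa vg Lalpha_mul mulmx1 mulmx0.
by rewrite subr0 subrr -scalar_mx_block.
Qed.

Lemma bstar_ge0 z : 0 <= bstar z.
Proof. by rewrite /bstar le_max lexx. Qed.

(** Complementary slackness and nonnegativity of the multiplier of [0 <= b]. *)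
Lemma bstarP z : bstar z * (I * bstar z - Dl z) = 0 /\ Dl z <= I * bstar z.
Proof.
have I0 : I != 0 by rewrite gt_eqF.
rewrite /bstar; have [D0|D0] := leP 0 (Dl z / I).
  by rewrite mulrCA divff// mulr1 subrr mulr0.
rewrite mul0r mulr0; split=> //.
by move: D0; rewrite pmulr_llt0 ?invr_gt0// => /ltW.
Qed.

Lemma hstar_value z :
  qform V (z - G *m hstar z) = profile z - I * bstar z ^+ 2.
Proof.
rewrite qform_residual subrr mulmx0 /qform /bform mulmx0 mxE addr0.
by have [/eqP + _] := bstarP z; rewrite mulrBr => /eqP; lra.
Qed.

Lemma h0star_value z : qform V (z - G *m h0star z) = profile z.
Proof.
rewrite qform_residual scale0r subr0 subrr mulmx0 /qform /bform mulmx0 mxE.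
by ring.
Qed.

(** Strong convexity in [b] of the concentrated criterion, restricted to the
    half-line: the multiplier [I * bstar z - Delta z] is nonnegative and is
    complementary to [bstar z]. *)
Lemma hstar_lower z a b : 0 <= b ->
  profile z - I * bstar z ^+ 2 + I * (b - bstar z) ^+ 2
    <= qform V (z - G *m param a b).
Proof.
move=> b0; rewrite qform_residual.
have := qform_ge0 (Ga *m (a - (L *m z - b *: (L *m g)))) Vpd.
have [_ D_le] := bstarP z.
have : 0 <= b * (I * bstar z - Dl z) by rewrite mulr_ge0// subr_ge0.
rewrite !expr2; lra.
Qed.

Lemma h0star_lower z a : profile z <= qform V (z - G *m param a 0).
Proof.
rewrite qform_residual.
have := qform_ge0 (Ga *m (a - (L *m z - 0 *: (L *m g)))) Vpd.
rewrite expr2; lra.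
Qed.

Lemma bstar_bound M : exists K : R, forall z, `|z| <= M -> `|bstar z| <= K.
Proof.
exists (k%:R ^+ 2 * `|V| * `|r| * M / I) => z zM.
have M0 : 0 <= M by exact: le_trans zM.
rewrite ger0_norm ?bstar_ge0// ge_max; apply/andP; split.
  by apply: mulr_ge0; [rewrite !mulr_ge0|rewrite invr_ge0 ltW].
rewrite ler_pM2r ?invr_gt0// (le_trans (ler_norm _))//.
by rewrite (le_trans (norm_bform_le _ _ _))// ler_wpM2l// !mulr_ge0.
Qed.

Lemma hstar_bound M : exists K : R, forall z, `|z| <= M ->
  `|hstar z| <= K /\ `|h0star z| <= K.
Proof.
have [B Bb] := bstar_bound M.
exists (k%:R * `|L| * M + B * `|L *m g| + B) => z zM.
have LzM : `|L *m z| <= k%:R * `|L| * M.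
  by rewrite (le_trans (mxnorm_mul _ _))// ler_wpM2l// mulr_ge0.
have bB := Bb _ zM; have B0 := le_trans (normr_ge0 _) bB.
split; rewrite (le_trans (mxnorm_param _ _))//.
  rewrite lerD// (le_trans (ler_normB _ _))// lerD//.
  by rewrite normrZ ler_wpM2r.
by rewrite normr0 addr0 -addrA (le_trans LzM)// lerDl addr_ge0// mulr_ge0.
Qed.

End limit_problem.

(** * Deterministic asymptotics along a filter *)

Section filter_limits.
Context (R : realType) (S : Type) (F : set_system S) (FF : Filter F).

Lemma cvgr0_le (V : normedModType R) (f : S -> V) (e : R) :
  f s @[s --> F] --> (0 : V) -> 0 < e -> \forall s \near F, `|f s| <= e.
Proof. by move=> /cvgr0Pnorm_le f0 e0; exact: f0. Qed.

Lemma qform_perturbation k (V : 'M[R]_k) (W : S -> 'M[R]_k) (u e : S -> 'cV[R]_k)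
    (K : R) :
  W s @[s --> F] --> V -> (\forall s \near F, `|u s| <= K) ->
  e s @[s --> F] --> (0 : 'cV[R]_k) ->
  qform (W s) (u s - e s) - qform V (u s) @[s --> F] --> (0 : R).
Proof.
move=> WV uK e0; apply/cvgr0Pnorm_le => eps eps0.
pose C : R := 1 + k%:R ^+ 2 * (`|K| + 1) ^+ 2 + 2 * (k%:R ^+ 2 * `|V| * (`|K| + 1)).
have K1 : 0 <= `|K| + 1 by rewrite addr_ge0.
have k2 : 0 <= k%:R ^+ 2 :> R by rewrite sqr_ge0.
have C1 : 1 <= C.
  by rewrite /C -addrA lerDl addr_ge0// !mulr_ge0 ?sqr_ge0.
have C0 : 0 < C by exact: lt_le_trans C1.
pose de := Num.min 1 (eps / C).
have de0 : 0 < de by rewrite /de lt_min ltr01 divr_gt0.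
have de1 : de <= 1 by rewrite /de ge_min lexx.
have deC : de * C <= eps by rewrite -ler_pdivlMr// /de ge_min lexx orbT.
have WVe : \forall s \near F, `|V - W s| <= de.
  by move/cvgrPdist_le : WV; apply.
have ee := cvgr0_le e0 de0.
near=> s.
have us : `|u s| <= `|K|.
  by apply: (@le_trans _ _ K); [near: s|exact: ler_norm].
have es : `|e s| <= de by near: s.
have Ws : `|W s - V| <= de by rewrite distrC; near: s.
have ues : `|u s - e s| <= `|K| + 1.
  by rewrite (le_trans (ler_normB _ _))// lerD// (le_trans es).
have us1 : `|u s| <= `|K| + 1 by rewrite (le_trans us)// lerDl.
have -> : qform (W s) (u s - e s) - qform V (u s) =
    bform (W s - V) (u s - e s) (u s - e s) - bform V (u s) (e s)
      - bform V (e s) (u s - e s).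
  have Vx x : bform V (u s - e s) x = bform V (u s) x - bform V (e s) x.
    by rewrite bformDl bformNl.
  have Vu : bform V (u s) (u s - e s) = bform V (u s) (u s) - bform V (u s) (e s).
    by rewrite bformDr bformNr.
  by rewrite -{1}(subrK V (W s)) /qform [in LHS]bformDm Vx Vu; ring.
apply: le_trans deC.
rewrite (le_trans (ler_normB _ _))//.
rewrite (le_trans (lerD (ler_normB _ _) (lexx _)))//.
have H1 : `|bform (W s - V) (u s - e s) (u s - e s)|
    <= k%:R ^+ 2 * de * (`|K| + 1) * (`|K| + 1).
  by rewrite (le_trans (norm_bform_le _ _ _))// !ler_pM// ?mulr_ge0.
have H2 : `|bform V (u s) (e s)| <= k%:R ^+ 2 * `|V| * (`|K| + 1) * de.
  by rewrite (le_trans (norm_bform_le _ _ _))// !ler_pM// ?mulr_ge0.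
have H3 : `|bform V (e s) (u s - e s)| <= k%:R ^+ 2 * `|V| * de * (`|K| + 1).
  by rewrite (le_trans (norm_bform_le _ _ _))// !ler_pM// ?mulr_ge0.
apply: (le_trans (lerD (lerD H1 H2) H3)).
rewrite -subr_ge0.
set X := (X in 0 <= X); have -> : X = de by rewrite /X /C; ring.
exact: ltW.
Unshelve. all: by end_near. Qed.

End filter_limits.

Section local_asymptotics.
Context (R : realType) (k : nat) (Omega : 'M[R]_k) (G : 'M[R]_(k, 2 + 1)).
Local Notation V := (invmx Omega).
Local Notation I := (Ieff Omega G).

Hypothesis Omega_pd : posdefmx Omega.
Hypothesis Ga_rank : \rank (Galpha G) = 2%N.
Hypothesis I_gt0 : 0 < I.

Context (Theta : set 'cV[R]_(2 + 1)) (alpha0 : 'cV[R]_2).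
Context (mun mutn : nat -> 'cV[R]_(2 + 1) -> 'cV[R]_k).
Context (mu : 'cV[R]_(2 + 1) -> 'cV[R]_k).
Local Notation thetab := (param alpha0 0).
Local Notation sq n := (Num.sqrt (n%:R : R)).

Hypothesis Theta_cone : Theta `<=` cone R.
Hypothesis Theta_local : exists2 rho : R, 0 < rho &
  forall h, cone R h -> `|h| < rho -> Theta (thetab + h).
Hypothesis mun_mu : forall e : R, 0 < e ->
  \forall n \near \oo, forall th, Theta th -> `|mun n th - mu th| <= e.
Hypothesis mun_G : forall e : R, 0 < e -> exists2 r : R, 0 < r &
  \forall n \near \oo, forall th, Theta th -> `|th - thetab| <= r ->
    `|mun n th - mun n thetab - G *m (th - thetab)| <= e * `|th - thetab|.
Hypothesis mutn_mun : forall e : R, 0 < e ->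
  \forall n \near \oo, forall th, Theta th ->
    sq n * `|mutn n th - mun n th| <= e.
Hypothesis identified : forall r : R, 0 < r -> exists2 e : R, 0 < e &
  forall th, Theta th -> `|mu th - mu thetab| <= e -> `|th - thetab| <= r.

Context (S : Type) (F : set_system S) (FF : Filter F).
Context (N : S -> nat) (y : S -> 'cV[R]_k) (W : S -> 'M[R]_k) (M : R).
Local Notation sN s := (sq (N s)).

Definition zscore s : 'cV[R]_k := sN s *: (y s - mun (N s) thetab).
Local Notation Zs := zscore.

Hypothesis N_oo : N s @[s --> F] --> \oo.
Hypothesis Z_bounded : \forall s \near F, `|Zs s| <= M.
Hypothesis W_cvg : W s @[s --> F] --> V.

(** The scaling makes all three quantities comparable with [zscore]: distances
    are multiplied by [sqrt n] and the quadratic criterion by [n]. *)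
Definition local s (th : 'cV[R]_(2 + 1)) : 'cV[R]_(2 + 1) :=
  sN s *: (th - thetab).

Definition remainder s (th : 'cV[R]_(2 + 1)) : 'cV[R]_k :=
  sN s *: (mutn (N s) th - mun (N s) thetab) - G *m local s th.

Definition crit s (th : 'cV[R]_(2 + 1)) : R :=
  (N s)%:R * qform (W s) (y s - mutn (N s) th).

Lemma near_N (Q : nat -> Prop) :
  (\forall n \near \oo, Q n) -> \forall s \near F, Q (N s).
Proof. exact: N_oo. Qed.

Lemma critE s th :
  crit s th = qform (W s) (Zs s - G *m local s th - remainder s th).
Proof.
rewrite /crit -[(N s)%:R in LHS]sqr_sqrtr// -qformZ; congr qform.
rewrite /remainder opprB addrA subrK /zscore -scalerBr.
by rewrite opprB addrA subrK.
Qed.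

Lemma thetab_Theta : Theta thetab.
Proof.
have [rho rho0 H] := Theta_local; rewrite -[thetab]addr0; apply: H.
  by exists 0, 0; split => //; rewrite /param raddf0 col_mx0.
by rewrite normr0.
Qed.

(** The linearization error of the mean is small relative to the distance to
    [thetab], hence small once multiplied by [sqrt n] at bounded local parameter;
    the error of the approximate mean is [o(1 / sqrt n)] uniformly. *)
Lemma remainder_cvg (t : S -> 'cV[R]_(2 + 1)) (K : R) :
  (\forall s \near F, Theta (t s)) -> t s @[s --> F] --> thetab ->
  (\forall s \near F, `|local s (t s)| <= K) ->
  remainder s (t s) @[s --> F] --> (0 : 'cV[R]_k).
Proof.
move=> tT tb hK; apply/cvgr0Pnorm_le => e e0.
have e2 : 0 < e / 2 by rewrite divr_gt0.
have K1 : 0 < `|K| + 1 by rewrite ltr_wpDl.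
have [r r0 /near_N mG] := mun_G (divr_gt0 e2 K1).
have /near_N mm := mutn_mun e2.
have tr : \forall s \near F, `|thetab - t s| <= r.
  by move/cvgrPdist_le : tb; apply.
near=> s.
have Tt : Theta (t s) by near: s.
have -> : remainder s (t s) = sN s *: (mutn (N s) (t s) - mun (N s) (t s)) +
    sN s *: (mun (N s) (t s) - mun (N s) thetab - G *m (t s - thetab)).
  rewrite /remainder /local -scalemxAr -scalerBr -scalerDr.
  by congr (_ *: _); apply/matrixP => i j; rewrite !mxE; ring.
rewrite (splitr e) (le_trans (ler_normD _ _))// lerD// normrZ ger0_norm ?sqrtr_ge0//.
  by near: s; apply: filterS2 tT mm => s Ts; exact.
have hs : `|local s (t s)| <= `|K|.
  by apply: (@le_trans _ _ K); [near: s|exact: ler_norm].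
have : `|mun (N s) (t s) - mun (N s) thetab - G *m (t s - thetab)|
    <= e / 2 / (`|K| + 1) * `|t s - thetab|.
  have /(_ _ Tt) : forall th, Theta th -> `|th - thetab| <= r ->
    `|mun (N s) th - mun (N s) thetab - G *m (th - thetab)|
      <= e / 2 / (`|K| + 1) * `|th - thetab| by near: s.
  by apply; rewrite distrC; near: s.
move=> /(ler_wpM2l (sqrtr_ge0 (N s)%:R)) /le_trans; apply.
rewrite mulrCA -[X in _ * (X * _)](ger0_norm (sqrtr_ge0 _)) -normrZ.
rewrite -/(local s (t s)) -[leRHS](divfK (lt0r_neq0 K1)).
rewrite ler_wpM2l ?(le_trans hs) ?lerDl//.
by apply: ltW; exact: divr_gt0.
Unshelve. all: by end_near. Qed.

Lemma residual_bounded (t : S -> 'cV[R]_(2 + 1)) (K : R) :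
  (\forall s \near F, `|local s (t s)| <= K) ->
  \forall s \near F, `|Zs s - G *m local s (t s)| <= M + (2 + 1)%:R * `|G| * K.
Proof.
move=> hK; near=> s.
rewrite (le_trans (ler_normB _ _))// lerD//; first by near: s.
rewrite (le_trans (mxnorm_mul _ _))// ler_wpM2l ?mulr_ge0//.
by near: s.
Unshelve. all: by end_near. Qed.

Lemma crit_cvg (t : S -> 'cV[R]_(2 + 1)) (K : R) :
  (\forall s \near F, Theta (t s)) -> t s @[s --> F] --> thetab ->
  (\forall s \near F, `|local s (t s)| <= K) ->
  crit s (t s) - qform V (Zs s - G *m local s (t s)) @[s --> F] --> (0 : R).
Proof.
move=> tT tb hK; under eq_fun do rewrite critE.
apply: qform_perturbation => //; first exact: residual_bounded hK.
exact: remainder_cvg hK.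
Qed.

Lemma crit_thetab_bounded :
  exists K : R, \forall s \near F, crit s thetab <= K.
Proof.
have loc0 s : local s thetab = 0 by rewrite /local subrr scaler0.
have c0 : crit s thetab - qform V (Zs s) @[s --> F] --> (0 : R).
  have -> : (fun s => crit s thetab - qform V (Zs s)) =
      (fun s => crit s thetab - qform V (Zs s - G *m local s thetab)).
    by apply/funext => s; rewrite loc0 mulmx0 subr0.
  apply: (@crit_cvg (fun=> thetab) 0); [|exact: cvg_cst|].
    by near=> s; exact: thetab_Theta.
  by near=> s; rewrite loc0 normr0.
exists (1 + k%:R ^+ 2 * `|V| * `|M| * `|M|).
have c1 := cvgr0_le FF c0 ltr01.
near=> s.
have ZM : `|Zs s| <= `|M|.
  by apply: (@le_trans _ _ M); [near: s|exact: ler_norm].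
rewrite -[leLHS](subrK (qform V (Zs s))) lerD//.
  by rewrite (le_trans (ler_norm _))//; near: s.
rewrite (le_trans (ler_norm _))// (le_trans (norm_bform_le _ _ _))//.
by rewrite !ler_pM// ?mulr_ge0.
Unshelve. all: by end_near. Qed.

(** Coercivity of the weight bounds the scaled residual, hence the scaled
    distance of the fitted mean to the true one; identification then gives
    consistency, and the left inverse of [G] turns the bound on the mean into
    one on the local parameter. *)
Lemma near_minimizer_local (t : S -> 'cV[R]_(2 + 1)) (rho : S -> R) :
  (\forall s \near F, Theta (t s)) ->
  (N s)%:R * rho s @[s --> F] --> (0 : R) ->
  (\forall s \near F, crit s (t s) <= crit s thetab + (N s)%:R * rho s) ->
  t s @[s --> F] --> thetab /\
  exists K : R, \forall s \near F, `|local s (t s)| <= K.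
Proof.
move=> tT rho0 tmin.
have Vpd := posdefmx_inv Omega_pd.
have [c c0 cV] := posdefmx_coercive Vpd.
have [K1 critK] := crit_thetab_bounded.
(* [de] makes the perturbation of the weight cost at most half of [c]. *)
pose K2 := Num.sqrt ((`|K1| + 1) / (c / 2)).
pose de := c / 2 / (k%:R ^+ 2 + 1).
have k1 : 0 < k%:R ^+ 2 + 1 :> R by rewrite ltr_wpDl// sqr_ge0.
have c2 : 0 < c / 2 by rewrite divr_gt0.
have de0 : 0 < de by rewrite divr_gt0.
have Wde : \forall s \near F, `|V - W s| <= de.
  by move/cvgrPdist_le : W_cvg; apply.
have rho1 := cvgr0_le FF rho0 ltr01.
have res : \forall s \near F, `|sN s *: (y s - mutn (N s) (t s))| <= K2.
  near=> s.
  set v := sN s *: _.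
  have qv : qform (W s) v <= `|K1| + 1.
    have -> : qform (W s) v = crit s (t s).
      by rewrite /v qformZ sqr_sqrtr.
    apply: (@le_trans _ _ (crit s thetab + (N s)%:R * rho s)); first by near: s.
    rewrite lerD//.
      by apply: (@le_trans _ _ K1); [near: s|exact: ler_norm].
    by rewrite (le_trans (ler_norm _))//; near: s.
  have Wv : `|bform (V - W s) v v| <= c / 2 * `|v| ^+ 2.
    rewrite (le_trans (norm_bform_le _ _ _))// -mulrA -expr2.
    rewrite ler_wpM2r ?sqr_ge0//.
    apply: (@le_trans _ _ (k%:R ^+ 2 * de)).
      by rewrite ler_wpM2l ?sqr_ge0//; near: s.
    by rewrite /de mulrA ler_pdivrMr// mulrC ler_wpM2l ?(ltW c2)// lerDl.
  have VW : qform V v = bform (V - W s) v v + qform (W s) v.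
    by rewrite /qform -bformDm subrK.
  have {}Wv := le_trans (ler_norm _) Wv.
  have cv := cV v.
  have vv : `|v| ^+ 2 <= (`|K1| + 1) / (c / 2).
    by rewrite ler_pdivlMr//; lra.
  have X0 : 0 <= (`|K1| + 1) / (c / 2) by rewrite (le_trans _ vv)// sqr_ge0.
  by rewrite -ler_sqr ?nnegrE ?sqrtr_ge0// sqr_sqrtr.
pose K3 := K2 + M + 1.
have mean : \forall s \near F,
    sN s * `|mun (N s) (t s) - mun (N s) thetab| <= K3.
  have /near_N mm := mutn_mun (@ltr01 R).
  near=> s.
  rewrite -[X in X * _](ger0_norm (sqrtr_ge0 _)) -normrZ.
  have -> : sN s *: (mun (N s) (t s) - mun (N s) thetab) =
     - (sN s *: (y s - mutn (N s) (t s))) + Zs s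
     - sN s *: (mutn (N s) (t s) - mun (N s) (t s)).
    rewrite /zscore -scalerN -scalerDr -scalerBr.
    by congr (_ *: _); apply/matrixP => i j; rewrite !mxE; ring.
  rewrite (le_trans (ler_normB _ _))// lerD//.
    rewrite (le_trans (ler_normD _ _))// lerD//; last by near: s.
    by rewrite normrN; near: s.
  rewrite normrZ ger0_norm ?sqrtr_ge0//.
  by near: s; apply: filterS2 tT mm => s Ts; exact.
have tcvg : t s @[s --> F] --> thetab.
  apply/cvgrPdist_le => r r0.
  have [e e0 idf] := identified r0.
  have e3 : 0 < e / 3 by rewrite divr_gt0.
  have /near_N mmu := mun_mu e3.
  have sqe : \forall n \near \oo, `|K3| + 1 <= e / 3 * sq n.
    have /cvgryPge H : (fun n : nat => n%:R : R) @ \oo --> +oo.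
      exact: cvgr_idn.
    near=> n; rewrite -ler_pdivrMl//.
    set A := (_ * _).
    have A0 : 0 <= A by rewrite mulr_ge0 ?invr_ge0 ?ltW// ltr_wpDl.
    rewrite -(ger0_norm A0) -sqrtr_sqr ler_wsqrtr//.
    by near: n; exact: H.
  have {}sqe := near_N sqe.
  near=> s; rewrite distrC; apply: idf; first by near: s.
  have s3 : `|mun (N s) (t s) - mun (N s) thetab| <= e / 3.
    have e3s : `|K3| + 1 <= e / 3 * sN s by near: s.
    have s0 : 0 < sN s.
      rewrite -(@pmulr_rgt0 _ (e / 3))//.
      by rewrite (lt_le_trans _ e3s)// ltr_wpDl.
    rewrite -(ler_pM2l s0) [leRHS]mulrC (le_trans _ e3s)//.
    apply: (@le_trans _ _ K3); first by near: s.
    by rewrite (le_trans (ler_norm _))// lerDl.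
  have mt : forall th, Theta th -> `|mun (N s) th - mu th| <= e / 3 by near: s.
  have Tt : Theta (t s) by near: s.
  have m1 := mt _ Tt; have m2 := mt _ thetab_Theta.
  have -> : mu (t s) - mu thetab =
      (mun (N s) (t s) - mun (N s) thetab) - (mun (N s) (t s) - mu (t s))
      + (mun (N s) thetab - mu thetab).
    by apply/matrixP => i j; rewrite !mxE; ring.
  rewrite (le_trans (ler_normD _ _))//.
  rewrite (le_trans (lerD (ler_normB _ _) (lexx _)))//; lra.
split=> //.
have [A AG] := G_left_inverse Omega_pd Ga_rank I_gt0.
pose C := k%:R * `|A| + 1.
have C0 : 0 < C by rewrite ltr_wpDl// mulr_ge0.
have hC s : `|local s (t s)| <= C * `|G *m local s (t s)|.
  rewrite -{1}[local s _]mul1mx -AG -mulmxA (le_trans (mxnorm_mul _ _))//.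
  by rewrite ler_wpM2r// /C lerDl.
have C20 : 0 < (C *+ 2)^-1 by rewrite invr_gt0 mulrn_wgt0.
have [r r0 /near_N mG] := mun_G C20.
have tr : \forall s \near F, `|thetab - t s| <= r.
  by move/cvgrPdist_le : tcvg; apply.
exists (C * K3 *+ 2); near=> s.
set h := local s (t s).
have Tt : Theta (t s) by near: s.
have lin : `|mun (N s) (t s) - mun (N s) thetab - G *m (t s - thetab)|
    <= (C *+ 2)^-1 * `|t s - thetab|.
  have /(_ _ Tt) : forall th, Theta th -> `|th - thetab| <= r ->
    `|mun (N s) th - mun (N s) thetab - G *m (th - thetab)|
      <= (C *+ 2)^-1 * `|th - thetab| by near: s.
  by apply; rewrite distrC; near: s.
have Gh : `|G *m h| <= K3 + (C *+ 2)^-1 * `|h|.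
  have -> : G *m h = sN s *: (mun (N s) (t s) - mun (N s) thetab)
     - sN s *: (mun (N s) (t s) - mun (N s) thetab - G *m (t s - thetab)).
    by rewrite -scalerBr opprB addrC subrK -scalemxAr.
  rewrite (le_trans (ler_normB _ _))// !normrZ ger0_norm ?sqrtr_ge0//.
  rewrite lerD//; first by near: s.
  by rewrite mulrCA ler_wpM2l ?sqrtr_ge0.
have : C * `|G *m h| <= C * K3 + `|h| / 2.
  rewrite (le_trans (ler_wpM2l (ltW C0) Gh))// mulrDr lerD//.
  have -> // : C * ((C *+ 2)^-1 * `|h|) = `|h| / 2.
  by rewrite -mulr_natr; field; rewrite gt_eqF.
move=> /(le_trans (hC s)); rewrite -/h -mulr_natr; lra.
Unshelve. all: by end_near. Qed.

(** Local parameters are realized inside [Theta] eventually, since the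
    cone at [thetab] is contained in [Theta] near its vertex. *)
Lemma crit_local_cvg (h : S -> 'cV[R]_(2 + 1)) (K : R) :
  (forall s, cone R (h s)) -> (\forall s \near F, `|h s| <= K) ->
  let t s := thetab + (sN s)^-1 *: h s in
  (\forall s \near F, Theta (t s)) /\
  crit s (t s) - qform V (Zs s - G *m h s) @[s --> F] --> (0 : R).
Proof.
move=> hc hK t.
have small (e : R) : 0 < e -> \forall s \near F, 0 < sN s /\ `|(sN s)^-1 *: h s| < e.
  move=> e0.
  have /near_N H : \forall n \near \oo, (`|K| + 1) / e <= sq n.
    have /cvgryPge H : (fun n : nat => n%:R : R) @ \oo --> +oo.
      exact: cvgr_idn.
    near=> n; set A := (_ / _).
    have A0 : 0 <= A by rewrite divr_ge0 ?(ltW e0)// addr_ge0.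
    rewrite -(ger0_norm A0) -sqrtr_sqr ler_wsqrtr//.
    by near: n; exact: H.
  near=> s.
  have Hs : (`|K| + 1) / e <= sN s by near: s.
  have s0 : 0 < sN s by rewrite (lt_le_trans _ Hs)// divr_gt0// ltr_wpDl.
  split=> //; rewrite normrZ ger0_norm ?invr_ge0 ?sqrtr_ge0//.
  rewrite ltr_pdivrMl// mulrC.
  rewrite ler_pdivrMr// mulrC in Hs.
  rewrite (lt_le_trans _ Hs)//.
  apply: (@le_lt_trans _ _ K); first by near: s.
  by rewrite (le_lt_trans (ler_norm _))// ltrDl.
have tT : \forall s \near F, Theta (t s).
  have [rho rho0 Tl] := Theta_local.
  apply: filterS (small _ rho0) => s [s0 hs]; apply: Tl => //.
  have [a [b [b0 hE]]] := hc s.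
  exists ((sN s)^-1 *: a), ((sN s)^-1 * b); rewrite hE paramZ; split=> //.
  by rewrite mulr_ge0// invr_ge0 ltW.
have tb : t s @[s --> F] --> thetab.
  apply/cvgrPdist_le => e e0; apply: filterS (small _ e0) => s [_ hs].
  by rewrite /t opprD addNKr normrN ltW.
have loc : \forall s \near F, local s (t s) = h s.
  apply: filterS (small _ ltr01) => s [s0 _].
  by rewrite /local /t addrC addKr scalerA divff ?gt_eqF// scale1r.
split=> //.
have := crit_cvg tT tb _; rewrite -/t => /(_ K) H.
have {}H : crit s (t s) - qform V (Zs s - G *m local s (t s)) @[s --> F] --> (0 : R).
  by apply: H; apply: filterS2 hK loc => s ? ->.
apply: cvg_trans H; apply: near_eq_cvg.
by apply: filterS loc => s ->.
Unshelve. all: by end_near. Qed.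

Lemma local_param s (a : 'cV[R]_2) (b : R) :
  local s (param a b) = param (sN s *: (a - alpha0)) (sN s * b).
Proof. by rewrite /local paramB subr0 paramZ. Qed.

(** Each near-minimizer is compared with the solution of the limit problem under
    the same constraint, carried back into [Theta]. The latter bounds the infimum
    from above, the former bounds it from below through [hstar_lower] and
    [h0star_lower], and the two bounds differ by [o(1)]; the quadratic gap in
    [hstar_lower] then forces the scaled [psi] towards [bstar]. *)
Lemma near_minimizer_expansion (th th0 : S -> 'cV[R]_(2 + 1))
    (iq iq0 rho : S -> R) :
  (forall s, Theta (th s)) -> (forall s, Theta (th0 s)) ->
  (forall s, dsubmx (th0 s) 0 0 = 0) ->
  (forall s t, Theta t -> (N s)%:R * iq s <= crit s t) ->
  (forall s a, Theta (param a 0) -> (N s)%:R * iq0 s <= crit s (param a 0)) ->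
  (forall s, crit s (th s) <= (N s)%:R * iq s + (N s)%:R * rho s) ->
  (forall s, crit s (th0 s) <= (N s)%:R * iq0 s + (N s)%:R * rho s) ->
  (N s)%:R * rho s @[s --> F] --> (0 : R) ->
  [/\ (th s @[s --> F] --> thetab /\
        exists K : R, \forall s \near F, `|local s (th s)| <= K),
      (th0 s @[s --> F] --> thetab /\
        exists K : R, \forall s \near F, `|local s (th0 s)| <= K),
      sN s * dsubmx (th s) 0 0 - bstar Omega G (Zs s) @[s --> F] --> (0 : R) &
      (N s)%:R * (iq0 s - iq s) - I * bstar Omega G (Zs s) ^+ 2
        @[s --> F] --> (0 : R)].
Proof.
move=> thT th0T th0E iqP iq0P thP th0P rho0.
have nT (t : S -> 'cV[R]_(2 + 1)) : (forall s, Theta (t s)) ->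
    \forall s \near F, Theta (t s) by move=> tT; near=> s.
have [thb [K hK]] : th s @[s --> F] --> thetab /\
    exists K : R, \forall s \near F, `|local s (th s)| <= K.
  apply: near_minimizer_local rho0 _; first exact: nT.
  near=> s; apply: le_trans (thP s) _; rewrite lerD2r.
  by apply: iqP; exact: thetab_Theta.
have [th0b [K0 hK0]] : th0 s @[s --> F] --> thetab /\
    exists K : R, \forall s \near F, `|local s (th0 s)| <= K.
  apply: near_minimizer_local rho0 _; first exact: nT.
  near=> s; apply: le_trans (th0P s) _; rewrite lerD2r.
  by apply: iq0P; exact: thetab_Theta.
have A := crit_cvg (nT _ thT) thb hK.
have A0 := crit_cvg (nT _ th0T) th0b hK0.
have [B hB] := hstar_bound I_gt0 M.
pose hs s := hstar Omega G (Zs s); pose h0s s := h0star Omega G (Zs s).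
have hs_cone s : cone R (hs s).
  exists (Lalpha Omega G *m Zs s - bstar Omega G (Zs s) *: (Lalpha Omega G *m gpsi G)).
  by exists (bstar Omega G (Zs s)); split; first exact: bstar_ge0.
have h0s_cone s : cone R (h0s s) by exists (Lalpha Omega G *m Zs s), 0.
have hsB : \forall s \near F, `|hs s| <= B.
  by apply: filterS Z_bounded => s /hB[].
have h0sB : \forall s \near F, `|h0s s| <= B.
  by apply: filterS Z_bounded => s /hB[].
have [T1 C1] := crit_local_cvg hs_cone hsB.
have [T0 C0] := crit_local_cvg h0s_cone h0sB.
pose t1 s := thetab + (sN s)^-1 *: hs s.
pose t0 s := thetab + (sN s)^-1 *: h0s s.
have key (e : R) : 0 < e -> \forall s \near F,
    I * (sN s * dsubmx (th s) 0 0 - bstar Omega G (Zs s)) ^+ 2 <= e /\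
    `|(N s)%:R * (iq0 s - iq s) - I * bstar Omega G (Zs s) ^+ 2| <= e.
  (* Four criterion approximations, and the tolerance counted twice. *)
  move=> e0; have e6 : 0 < e / 6 by rewrite divr_gt0.
  have Ae := cvgr0_le FF A e6; have A0e := cvgr0_le FF A0 e6.
  have Ce := cvgr0_le FF C1 e6; have C0e := cvgr0_le FF C0 e6.
  have re := cvgr0_le FF rho0 e6.
  near=> s.
  set bs := bstar Omega G (Zs s).
  have loc_psi t : dsubmx (local s t) 0 0 = sN s * dsubmx t 0 0.
    by rewrite [t in LHS]paramE local_param param_psi.
  have low : profile Omega G (Zs s) - I * bs ^+ 2 +
      I * (sN s * dsubmx (th s) 0 0 - bs) ^+ 2
      <= qform V (Zs s - G *m local s (th s)).
    rewrite [th s in leRHS]paramE local_param.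
    apply: hstar_lower => //; rewrite mulr_ge0 ?sqrtr_ge0//.
    by apply: (@cone_param _ (usubmx (th s))); rewrite -paramE; exact: Theta_cone.
  have low0 : profile Omega G (Zs s) <= qform V (Zs s - G *m local s (th0 s)).
    by rewrite [th0 s]paramE th0E local_param mulr0; exact: h0star_lower.
  have val : qform V (Zs s - G *m hs s) = profile Omega G (Zs s) - I * bs ^+ 2.
    exact: hstar_value.
  have val0 : qform V (Zs s - G *m h0s s) = profile Omega G (Zs s).
    exact: h0star_value.
  have T1s : Theta (t1 s) by near: s.
  have T0s : Theta (t0 s) by near: s.
  have up : (N s)%:R * iq s <= crit s (t1 s) by exact: iqP.
  have up0 : (N s)%:R * iq0 s <= crit s (t0 s).
    move: T0s; have -> : t0 s =
        param (alpha0 + (sN s)^-1 *: (Lalpha Omega G *m Zs s)) 0.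
      by rewrite /t0 /h0s /h0star paramZ mulr0 paramD addr0.
    exact: iq0P.
  have thPs := thP s; have th0Ps := th0P s.
  have /ler_normlP[Ae1 Ae2] :
      `|crit s (th s) - qform V (Zs s - G *m local s (th s))| <= e / 6.
    by near: s.
  have /ler_normlP[A0e1 A0e2] :
      `|crit s (th0 s) - qform V (Zs s - G *m local s (th0 s))| <= e / 6.
    by near: s.
  have /ler_normlP[Ce1 Ce2] :
      `|crit s (t1 s) - qform V (Zs s - G *m hs s)| <= e / 6.
    by near: s.
  have /ler_normlP[C0e1 C0e2] :
      `|crit s (t0 s) - qform V (Zs s - G *m h0s s)| <= e / 6.
    by near: s.
  have /ler_normlP[re1 re2] : `|(N s)%:R * rho s| <= e / 6 by near: s.
  have X0 : 0 <= I * (sN s * dsubmx (th s) 0 0 - bs) ^+ 2.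
    by rewrite mulr_ge0 ?sqr_ge0// ltW.
  move: (I * (_ - bs) ^+ 2) low X0 => X low X0.
  rewrite mulrBr; move: (I * bs ^+ 2) low val => Y low val.
  by split; [|apply/ler_normlP; split]; lra.
split=> //; [by split=> //; exists K|by split=> //; exists K0| |]; last first.
  by apply/cvgr0Pnorm_le => e e0; apply: filterS (key _ e0) => s [].
apply/cvgr0Pnorm_le => e e0.
have Ie : 0 < I * e ^+ 2 by rewrite mulr_gt0 ?exprn_gt0.
apply: filterS (key _ Ie) => s [+ _].
rewrite ler_pM2l// => xe.
by rewrite -ler_sqr ?nnegrE ?(ltW e0)// real_normK ?num_real.
Unshelve. all: by end_near. Qed.

End local_asymptotics.

(** * Uniform approximation, linearization and identification *)

Section moduli.
Context (R : realType).

Lemma cvge0_lt {S : Type} (F : set_system S) {FF : Filter F} (u : S -> \bar R)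
    (e : R) :
  u s @[s --> F] --> 0%E -> 0 < e -> \forall s \near F, (u s < e%:E)%E.
Proof.
move=> u0 e0; have e0' : (0 < e%:E)%E by rewrite lte_fin.
exact: (u0 _ (open_ereal_lt' e0')).
Qed.

Lemma sup_cvg0_near k (Theta : set 'cV[R]_(2 + 1))
    (c : nat -> R) (f : nat -> 'cV[R]_(2 + 1) -> 'cV[R]_k) :
  (forall n, 0 <= c n) ->
  ((c n)%:E * ereal_sup [set (enorm (f n th))%:E | th in Theta])%E
    @[n --> \oo] --> 0%E ->
  forall e : R, 0 < e -> \forall n \near \oo, forall th, Theta th ->
    c n * `|f n th| <= e.
Proof.
move=> c0 f0 e e0; apply: filterS (cvge0_lt f0 e0) => n fn th Tth.
apply: (@le_trans _ _ (c n * enorm (f n th))).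
  by rewrite ler_wpM2l// mxnorm_le_enorm.
rewrite -lee_fin EFinM (le_trans _ (ltW fn))// lee_wpmul2l ?lee_fin//.
by apply: ereal_sup_ubound; exists th.
Qed.

(** A radius at which the limit superior is below [e / 3] serves for all large
    [n]; the case [th = thetab], excluded from the quotient, is trivial. *)
Lemma linearization_near k (Theta : set 'cV[R]_(2 + 1)) (thetab : 'cV[R]_(2 + 1))
    (mun : nat -> 'cV[R]_(2 + 1) -> 'cV[R]_k) (G : 'M[R]_(k, 2 + 1)) :
  limn_esup (fun n => ereal_sup
      [set (enorm (mun n th - mun n thetab - G *m (th - thetab))
              / enorm (th - thetab))%:E
        | th in [set th | Theta th /\ 0 < enorm (th - thetab) <= r]])
    @[r --> (0 : R)^'+] --> 0%E ->
  forall e : R, 0 < e -> exists2 r : R, 0 < r &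
    \forall n \near \oo, forall th, Theta th -> `|th - thetab| <= r ->
      `|mun n th - mun n thetab - G *m (th - thetab)| <= e * `|th - thetab|.
Proof.
move=> H e e0; have e3 : 0 < e / 3 by rewrite divr_gt0.
pose ratio r n := ereal_sup
      [set (enorm (mun n th - mun n thetab - G *m (th - thetab))
              / enorm (th - thetab))%:E
        | th in [set th | Theta th /\ 0 < enorm (th - thetab) <= r]].
near (0 : R)^'+ => r.
have r0 : 0 < r by near: r; exact: nbhs_right_gt.
have : (limn_esup (ratio r) < (e / 3)%:E)%E by near: r; exact: cvge0_lt H e3.
rewrite /limn_esup /limf_esup => /ereal_inf_lt[_ [A Aoo <-]] Ae.
(* The Euclidean norm is at most 3 times the sup norm in dimension 3. *)
exists (r / 3); first by rewrite divr_gt0.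
apply: filterS Aoo => n An th Tth thr.
have en : enorm (th - thetab) <= 3 * `|th - thetab| by exact: enorm_le_mxnorm.
have [d0|d0] := eqVneq (th - thetab) 0.
  have -> : th = thetab by apply/eqP; rewrite -subr_eq0 d0.
  by rewrite !subrr mulmx0 subr0 !normr0 mulr0.
have enorm0 : 0 < enorm (th - thetab).
  by apply: lt_le_trans (mxnorm_le_enorm _); rewrite normr_gt0.
rewrite (le_trans (mxnorm_le_enorm _))//.
apply: (@le_trans _ _ (e / 3 * enorm (th - thetab))); last first.
  by move: (ler_wpM2l (ltW e3) en); lra.
rewrite -ler_pdivrMr// -lee_fin (le_trans _ (ltW Ae))//.
apply: (@le_trans _ _ (ratio r n)).
  apply: ereal_sup_ubound; exists th => //; split=> //; rewrite enorm0/=; lra.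
by apply: ereal_sup_ubound; exists n.
Unshelve. all: by end_near. Qed.

(** On the compact set of parameters at distance at least [r] from [thetab],
    the discrepancy of the means attains its minimum, which is not zero. *)
Lemma identified_separated k (Theta : set 'cV[R]_(2 + 1))
    (thetab : 'cV[R]_(2 + 1)) (mu : 'cV[R]_(2 + 1) -> 'cV[R]_k) :
  compact Theta -> {within Theta, continuous mu} ->
  (forall th, Theta th -> mu th = mu thetab -> th = thetab) ->
  forall r : R, 0 < r -> exists2 e : R, 0 < e &
    forall th, Theta th -> `|mu th - mu thetab| <= e -> `|th - thetab| <= r.
Proof.
move=> cT cmu idf r r0.
pose K := Theta `&` [set th | r <= `|th - thetab|].
have [K0|nK0] := pselect (K !=set0); last first.
  exists 1 => // th Tth _; rewrite leNgt; apply/negP => rth.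
  by apply: nK0; exists th; split => //; exact: ltW.
have cK : compact K.
  apply: compact_closedI => //.
  have cd : continuous (fun th : 'cV[R]_(2 + 1) => `|th - thetab|).
    by move=> th; exact: cvg_norm (cvgB cvg_id (cvg_cst _)).
  move/continuous_closedP : cd => /(_ [set x | r <= x]); apply.
  exact: closed_ge.
have cf : {within K, continuous (fun th => `|mu th - mu thetab|)}.
  have cmuK : {within K, continuous mu} by apply: continuous_subspaceW cmu => th [].
  by move=> th; exact: cvg_norm (cvgB (cmuK th) (cvg_cst _)).
have [c cK' cmin] := compact_EVT_min K0 cK cf.
have mc : 0 < `|mu c - mu thetab|.
  rewrite normr_gt0 subr_eq0; apply/eqP => mcb.
  move: cK'; rewrite inE => -[Tc]; rewrite /= (idf _ Tc mcb) subrr normr0.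
  by rewrite leNgt r0.
exists (`|mu c - mu thetab| / 2); first by rewrite divr_gt0.
move=> th Tth mth; rewrite leNgt; apply/negP => rth.
have /cmin : th \in K by rewrite inE; split => //; exact: ltW.
by rewrite leNgt => /negP; apply; lra.
Qed.

End moduli.

(** * Random elements *)

Section random_elements.
Context (R : realType) d (T : measurableType d).

Lemma random_elementP (S : ptopologicalType) (X : T -> S) :
  random_element X <-> forall A, open A -> measurable (X @^-1` A).
Proof.
split=> [mX A oA|mX].
  rewrite -[_ @^-1` _]setTI; apply: mX => //.
  exact: sub_sigma_algebra.
apply: (@measurability _ _ _ (g_sigma_algebraType (@open S)) setT X (@open S)) => //.
by move=> _ [A oA <-]; rewrite setTI; exact: mX.
Qed.

Lemma random_element_measurable (X : T -> R) :
  random_element X <-> measurable_fun [set: T] X.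
Proof.
split=> [/random_elementP mX|mX].
  apply: (measurability _ (RGenOpens.measurableE R)).
  by move=> _ [_ [a [b ->] <-]]; rewrite setTI; apply/mX/interval_open.
apply/random_elementP => A oA; rewrite -[_ @^-1` _]setTI.
by apply: mX => //; exact: open_measurable.
Qed.

Lemma random_element_comp (S S' : ptopologicalType) (X : T -> S) (g : S -> S') :
  continuous g -> random_element X -> random_element (g \o X).
Proof.
move=> /continuousP cg /random_elementP mX; apply/random_elementP => A oA.
by rewrite comp_preimage; exact/mX/cg.
Qed.

Lemma random_element_real (S : ptopologicalType) (X : T -> S) (g : S -> R) :
  continuous g -> random_element X -> measurable_fun [set: T] (g \o X).
Proof. by move=> cg mX; apply/random_element_measurable/random_element_comp. Qed.

Lemma measurable_lt_cst (X : T -> R) c :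
  measurable_fun [set: T] X -> measurable [set w | X w < c].
Proof.
move=> mX; rewrite -[X in measurable X]setTI.
by have := mX measurableT _ (measurable_itv `]-oo, c[); rewrite set_itvE.
Qed.

Lemma measurable_ge_cst (X : T -> R) c :
  measurable_fun [set: T] X -> measurable [set w | c <= X w].
Proof.
move=> mX; rewrite -[X in measurable X]setTI.
by have := mX measurableT _ (measurable_itv `[c, +oo[); rewrite set_itvE.
Qed.

Lemma measurable_gt_cst (X : T -> R) c :
  measurable_fun [set: T] X -> measurable [set w | c < X w].
Proof.
move=> mX; rewrite -[X in measurable X]setTI.
by have := mX measurableT _ (measurable_itv `]c, +oo[); rewrite set_itvE.
Qed.

End random_elements.

Section expectation_bounds.
Context (R : realType) d (T : measurableType d) (P : probability T R).

Lemma bounded_funP (S : Type) (f : S -> R) :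
  bounded_fun f -> exists2 B, 0 < B & forall x, `|f x| <= B.
Proof.
move=> fB; near (+oo : set_system R) => B; exists B.
  by near: B; exact: nbhs_pinfty_gt.
have : [set: S] `<=` [set x | `|f x| <= B] by near: B.
by move=> h x; exact: h.
Unshelve. all: by end_near. Qed.

Lemma bounded_fun_le (S : Type) (f : S -> R) B :
  (forall x, `|f x| <= B) -> bounded_fun f.
Proof.
by move=> fB; exists B; split; rewrite ?num_real// => M /ltW BM x _; exact: le_trans BM.
Qed.

Lemma bounded_integrable (X : T -> R) B : measurable_fun [set: T] X ->
  (forall w, `|X w| <= B) -> P.-integrable [set: T] (EFin \o X).
Proof.
move=> mX XB; apply: measurable_bounded_integrable => //.
  exact: le_lt_trans (probability_le1 P measurableT) (ltry 1).
by exists B; split; rewrite ?num_real// => x /ltW Bx w _ /=; exact: le_trans Bx.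
Qed.

Lemma expectation_bounded_fin (X : T -> R) B : measurable_fun [set: T] X ->
  (forall w, `|X w| <= B) -> 'E_P[X]%E \is a fin_num.
Proof.
move=> mX XB; rewrite unlock; apply: integrable_fin_num => //.
exact: bounded_integrable XB.
Qed.

(** On the exceptional event two functions bounded by [B] differ by at most
    [2 * B]. *)
Lemma expectation_le_indic (X Y : T -> R) B e (A : set T) :
  measurable_fun [set: T] X -> measurable_fun [set: T] Y -> measurable A ->
  (forall w, `|X w| <= B) -> (forall w, `|Y w| <= B) -> 0 <= e ->
  (forall w, ~ A w -> X w <= Y w + e) ->
  ('E_P[X] <= 'E_P[Y] + (e%:E + (2 * B)%:E * P A))%E.
Proof.
move=> mX mY mA XB YB e0 XY; rewrite unlock.
have iX := bounded_integrable mX XB; have iY := bounded_integrable mY YB.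
have ie : P.-integrable [set: T] (EFin \o cst e).
  by apply: (@bounded_integrable _ `|e|) => //.
have iA : P.-integrable [set: T] (EFin \o (fun w => 2 * B * \1_A w)).
  apply: (@bounded_integrable _ `|2 * B|).
    by apply: measurable_funM => //; exact: measurable_indic.
  move=> w; rewrite normrM ler_piMr// indicE.
  by case: (_ \in _); rewrite ?normr0 ?normr1.
have -> : (e%:E + (2 * B)%:E * P A =
    \int[P]_w (e%:E + (2 * B * \1_A w)%:E))%E.
  rewrite integralD//=; have := expectation_cst P e; rewrite unlock => /= ->.
  congr (_ + _)%E.
  under eq_integral do rewrite EFinM.
  rewrite integralZl//; last exact: integrable_indic.
  by rewrite integral_indic// setIT.
rewrite -integralD//; last exact: integrableD.
apply: le_integral => //.
  by apply: integrableD => //; exact: integrableD.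
move=> w _; rewrite -!EFinD lee_fin indicE.
have [wA|wA] := boolP (w \in A).
  have := XB w; have := YB w; rewrite !ler_norml => /andP[Y1 _] /andP[_ X1].
  by rewrite /=; lra.
rewrite /= mulr0 addr0 XY//.
by move=> /mem_set; exact/negP.
Qed.

End expectation_bounds.

(** * Convergence in law and in probability *)

(** Only [x] is confined to the segment; compactness, in its near-covering form,
    provides one [de] for all such [x]. *)
Lemma segment_unif_continuous (R : realType) (f : R -> R) (M e : R) :
  continuous f -> 0 < e -> exists2 de, 0 < de &
    forall x y, `|x| <= M -> `|x - y| < de -> `|f x - f y| <= e.
Proof.
move=> cf e0.
pose good de x := forall y, `|x - y| < de -> `|f x - f y| <= e.
have /compact_near_coveringP/near_covering_withinP := @segment_compact R (- M) M.
move=> /(_ R ((0 : R)^'+) good _) cov.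
have : \forall de \near (0 : R)^'+, `[- M, M] `<=` good de.
  apply: cov => x _.
  have /cvgrPdist_le/(_ (e / 2)) := cf x.
  rewrite divr_gt0// => /(_ isT) /nbhs_ballP[r /= r0 xr].
  have r2 : 0 < r / 2 by rewrite divr_gt0.
  exists (ball x (r / 2), [set de | de < r / 2]) => /=.
    split; first by apply/nbhs_ballP; exists (r / 2).
    exact: nbhs_right_lt.
  move=> [x' de] [/= xx' de2] _ y x'y.
  have fx' : `|f x - f x'| <= e / 2.
    by apply: xr; apply: le_ball xx'; lra.
  have fy : `|f x - f y| <= e / 2.
    apply: xr; rewrite /ball/=; rewrite /ball/= in xx'.
    by rewrite -(subrKA x') (le_lt_trans (ler_normD _ _))//; lra.
  rewrite -(subrKA (f x)) (le_trans (ler_normD _ _))// distrC.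
  lra.
move=> H; near (0 : R)^'+ => de; exists de.
  by near: de; exact: nbhs_right_gt.
move=> x y xM; suff : good de x by apply.
have : `[- M, M] `<=` good de by near: de.
by apply; rewrite /= in_itv/= -ler_norml.
Unshelve. all: by end_near. Qed.

Lemma continuous_max0 (R : realType) (S : topologicalType) (f : S -> R) :
  continuous f -> continuous (fun x => Num.max 0 (f x)).
Proof.
move=> cf x.
apply: (@continuous_max _ _ (fun=> 0)); first exact: cst_continuous.
exact: cf.
Qed.

Lemma continuous_min1 (R : realType) (S : topologicalType) (f : S -> R) :
  continuous f -> continuous (fun x => Num.min 1 (f x)).
Proof.
move=> cf x.
apply: (@continuous_min _ _ (fun=> 1)); first exact: cst_continuous.
exact: cf.
Qed.

Lemma cvg_in_law_ext (R : realType) (S : ptopologicalType)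
    (d : nat -> measure_display) (T : forall n, measurableType (d n))
    (P : forall n, probability (T n) R) (X Y : forall n, T n -> S)
    (d' : measure_display) (T' : measurableType d') (P' : probability T' R)
    (Z : T' -> S) :
  (forall n w, X n w = Y n w) -> cvg_in_law P X P' Z -> cvg_in_law P Y P' Z.
Proof.
move=> XY [mX mZ XZ].
have E n : X n = Y n by apply/funext => w; exact: XY.
split=> // [n|f cf fb]; first by rewrite -E; exact: mX.
have := XZ f cf fb.
by under eq_fun do rewrite E.
Qed.

Section convergence.
Context (R : realType) (d : nat -> measure_display).
Context (T : forall n, measurableType (d n)) (P : forall n, probability (T n) R).

Lemma cvg_prob0 (B : forall n, set (T n)) :
  (forall n, measurable (B n)) ->
  (forall eta : R, 0 < eta -> \forall n \near \oo, (P n (B n) <= eta%:E)%E) ->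
  P n (B n) @[n --> \oo] --> 0%E.
Proof.
move=> mB PB; apply/fine_cvgP; split.
  by near=> n; exact: fin_num_measure.
apply/cvgr0Pnorm_le => e e0; apply: filterS (PB _ e0) => n.
rewrite ger0_norm ?fine_ge0// -lee_fin /= fineK//; exact: fin_num_measure.
Unshelve. all: by end_near. Qed.

Lemma cvg_prob0_le (B : forall n, set (T n)) (eta : R) :
  P n (B n) @[n --> \oo] --> 0%E -> 0 < eta ->
  \forall n \near \oo, (P n (B n) <= eta%:E)%E.
Proof.
by move=> B0 eta0; apply: filterS (cvge0_lt B0 eta0) => n /ltW.
Qed.

Context (d' : measure_display) (T' : measurableType d') (P' : probability T' R).

Lemma cvg_in_law_comp (S S' : ptopologicalType) (X : forall n, T n -> S)
    (X' : T' -> S) (g : S -> S') :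
  continuous g -> cvg_in_law P X P' X' ->
  cvg_in_law P (fun n w => g (X n w)) P' (fun w => g (X' w)).
Proof.
move=> cg [mX mX' XX']; split=> [n||f cf fB].
- exact: random_element_comp.
- exact: random_element_comp.
have [B B0 Bf] := bounded_funP fB.
apply: (XX' (f \o g)); last by apply: (@bounded_fun_le _ _ _ B) => x; exact: Bf.
by move=> x; apply: continuous_comp; [exact: cg|exact: cf].
Qed.

(** A sequence converging in law is tight: the indicator of a tail is bounded
    by a continuous function that is itself bounded by the indicator of a
    slightly larger tail. *)
Lemma cvg_in_law_tight (X : forall n, T n -> R) (X' : T' -> R) :
  cvg_in_law P X P' X' -> forall eta : R, 0 < eta ->
  exists M : R, \forall n \near \oo, (P n [set w | (M < `|X n w|)%R] <= eta%:E)%E.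
Proof.
move=> [mX mX' XX'] eta eta0.
have mnX' : measurable_fun [set: T'] (fun w => `|X' w|).
  by apply: (random_element_real _ mX'); exact: norm_continuous.
have mnX n : measurable_fun [set: T n] (fun w => `|X n w|).
  by apply: (random_element_real _ (mX n)); exact: norm_continuous.
have tail : P' [set w | m%:R < `|X' w|] @[m --> \oo] --> 0%E.
  rewrite [X in _ --> X](_ : _ = P' (\bigcap_m [set w | m%:R < `|X' w|])).
    apply: nonincreasing_cvg_mu.
    - exact: le_lt_trans (probability_le1 P' (measurable_gt_cst _ mnX')) (ltry 1).
    - by move=> m; exact: measurable_gt_cst.
    - by apply: bigcapT_measurable => m; exact: measurable_gt_cst.
    - move=> m n mn; apply/subsetPset => w /=; apply: le_lt_trans.
      by rewrite ler_nat.
  rewrite (_ : \bigcap_m _ = set0) ?measure0//.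
  apply/seteqP; split => // w /= H.
  have := H (Num.truncn `|X' w|).+1 I; rewrite /= ltNge => /negP; apply.
  by rewrite ltW// truncnS_gt.
have eta2 : 0 < eta / 2 by rewrite divr_gt0.
have [m _ /(_ m (leqnn m)) tm] := cvge0_lt tail eta2.
(* [phi] is a ramp in the absolute value, from 0 at [m] to 1 at [m + 1]. *)
pose phi (x : R) := Num.min 1 (Num.max 0 (`|x| - m%:R)).
have cphi : continuous phi.
  apply: continuous_min1; apply: continuous_max0 => y.
  exact: cvgB (@norm_continuous _ R _) (cvg_cst _).
have phi0 x : 0 <= phi x by rewrite /phi le_min ler01 le_max lexx.
have phi1 x : phi x <= 1 by rewrite /phi ge_min lexx.
have phiB x : `|phi x| <= 1 by rewrite ger0_norm.
have mphi : measurable_fun [set: T'] (phi \o X') by exact: random_element_real.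
have E' : ('E_P'[phi \o X'] < eta%:E)%E.
  apply: (@le_lt_trans _ _ ((eta / 2)%:E)); last by rewrite lte_fin; lra.
  apply: le_trans (ltW tm); rewrite unlock.
  rewrite -(setIT [set w | _]) -integral_indic//; last exact: measurable_gt_cst.
  apply: ge0_le_integral => //.
  - by move=> w _; rewrite lee_fin phi0.
  - exact/measurable_EFinP.
  - by apply/measurable_EFinP/measurable_indic; exact: measurable_gt_cst.
  move=> w _; rewrite lee_fin indicE.
  case: (boolP (w \in _)) => [_|wm]; first exact: phi1.
  rewrite /= /phi ge_min; apply/orP; right; rewrite ge_max lexx/= subr_le0 leNgt.
  by apply: contra wm => wm; rewrite inE.
have phib : bounded_fun phi by exact: bounded_fun_le phiB.
have El := XX' phi cphi phib.
have finE' : ('E_P'[phi \o X'])%E \is a fin_num.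
  by apply: (@expectation_bounded_fin _ _ _ _ _ 1) => // w; exact: phiB.
have Elt : \forall n \near \oo, ('E_(P n)[phi \o X n] < eta%:E)%E.
  by move: E' El; rewrite -(fineK finE') => E' /(_ _ (open_ereal_lt' E')).
exists (m%:R + 1); apply: filterS Elt => n /ltW; apply: le_trans.
rewrite unlock -(setIT [set w | m%:R + 1 < `|X n w|]) -integral_indic//; last first.
  exact: measurable_gt_cst.
apply: ge0_le_integral => //.
- by apply/measurable_EFinP/measurable_indic; exact: measurable_gt_cst.
- by apply/measurable_EFinP; exact: random_element_real.
move=> w _; rewrite lee_fin indicE.
case: (boolP (w \in _)) => [|_]; last exact: phi0.
rewrite inE /= => mw; rewrite /phi le_min lexx le_max/=; apply/orP; right; lra.
Qed.

(** Outside an event of small probability the first sequence lies in a fixed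
    segment, on which the test function is uniformly continuous, and the second
    one is close to it. *)
Lemma cvg_in_law_slutsky (X Y : forall n, T n -> R) (X' : T' -> R) :
  cvg_in_law P X P' X' -> (forall n, random_element (Y n)) ->
  (forall e : R, 0 < e -> P n [set w | e <= `|Y n w - X n w|] @[n --> \oo] --> 0%E) ->
  cvg_in_law P Y P' X'.
Proof.
move=> cX mY YX; have [mX mX' XX'] := cX; split=> // f cf fb.
have [B B0 fB] := bounded_funP fb.
have mfX n : measurable_fun [set: T n] (f \o X n) by exact: random_element_real.
have mfY n : measurable_fun [set: T n] (f \o Y n) by exact: random_element_real.
have finX n : ('E_(P n)[f \o X n])%E \is a fin_num.
  by apply: (@expectation_bounded_fin _ _ _ _ _ B) => // w; exact: fB.
have finY n : ('E_(P n)[f \o Y n])%E \is a fin_num.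
  by apply: (@expectation_bounded_fin _ _ _ _ _ B) => // w; exact: fB.
have finX' : ('E_P'[f \o X'])%E \is a fin_num.
  apply: (@expectation_bounded_fin _ _ _ _ _ B) => //.
    exact: random_element_real.
  by move=> w; exact: fB.
have := XX' f cf fb; rewrite -(fineK finX') => /fine_cvgP[_ Xl].
apply/fine_cvgP; split; first by near=> n; exact: finY.
have dist0 : fine 'E_(P n)[f \o X n]%E - fine 'E_(P n)[f \o Y n]%E
    @[n --> \oo] --> (0 : R).
  apply/cvgr0Pnorm_le => e e0.
  have e2 : 0 < e / 2 by rewrite divr_gt0.
  pose eta := e / 2 / (2 * B) / 2.
  have eta0 : 0 < eta by rewrite !divr_gt0 ?mulr_gt0.
  have [M XM] := cvg_in_law_tight cX eta0.
  have [de de0 unif] := segment_unif_continuous M cf e2.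
  have YXe := cvg_prob0_le (YX de de0) eta0.
  near=> n.
  have PA1 : (P n [set w | (M < `|X n w|)%R] <= eta%:E)%E by near: n.
  have PA2 : (P n [set w | (de <= `|Y n w - X n w|)%R] <= eta%:E)%E by near: n.
  have mnX : measurable_fun [set: T n] (fun w => `|X n w|).
    by apply: (random_element_real _ (mX n)); exact: norm_continuous.
  have mD : measurable_fun [set: T n] (fun w => `|Y n w - X n w|).
    apply: measurableT_comp; first exact: normr_measurable.
    by apply: measurable_funB; exact/random_element_measurable.
  set A1 := [set w | M < `|X n w|]; set A2 := [set w | de <= `|Y n w - X n w|].
  have mA1 : measurable A1 by exact: measurable_gt_cst.
  have mA2 : measurable A2 by exact: measurable_ge_cst.
  have PA : ((2 * B)%:E * P n (A1 `|` A2) <= (e / 2)%:E)%E.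
    apply: (@le_trans _ _ ((2 * B)%:E * (eta + eta)%:E)%E).
      apply: lee_wpmul2l; first by rewrite lee_fin mulr_ge0// ltW.
      by rewrite (le_trans (measureU2 _ mA1 mA2))// EFinD leeD.
    rewrite -EFinM lee_fin /eta.
    by rewrite -splitr mulrC divfK// gt_eqF// mulr_gt0.
  have close w : ~ (A1 `|` A2) w -> `|f (X n w) - f (Y n w)| <= e / 2.
    move=> /not_orP[/negP A1w /negP A2w]; apply: unif; first by rewrite leNgt.
    by rewrite distrC ltNge.
  have bound (U V : T n -> R) :
      measurable_fun [set: T n] U -> measurable_fun [set: T n] V ->
      (forall w, `|U w| <= B) -> (forall w, `|V w| <= B) ->
      (forall w, ~ (A1 `|` A2) w -> U w <= V w + e / 2) ->
      ('E_(P n)[U] <= 'E_(P n)[V] + e%:E)%E.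
    move=> mU mV UB VB UV.
    apply: (le_trans (expectation_le_indic (P n) mU mV (measurableU _ _ mA1 mA2)
      UB VB (ltW e2) UV)).
    by rewrite leeD2l// [e in leRHS]splitr EFinD leeD2l.
  have b1 : ('E_(P n)[f \o X n] <= 'E_(P n)[f \o Y n] + e%:E)%E.
    apply: bound => //; [by move=> w; exact: fB|by move=> w; exact: fB|move=> w Aw].
    by rewrite /= -lerBlDl (le_trans (ler_norm _))// close.
  have b2 : ('E_(P n)[f \o Y n] <= 'E_(P n)[f \o X n] + e%:E)%E.
    apply: bound => //; [by move=> w; exact: fB|by move=> w; exact: fB|move=> w Aw].
    by rewrite /= -lerBlDl (le_trans (ler_norm _))// distrC close.
  rewrite -(fineK (finX n)) -(fineK (finY n)) -EFinD lee_fin in b1.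
  rewrite -(fineK (finX n)) -(fineK (finY n)) -EFinD lee_fin in b2.
  by apply/ler_normlP; split; lra.
rewrite (_ : fine \o _ = fun n => fine 'E_(P n)[f \o X n]%E -
  (fine 'E_(P n)[f \o X n]%E - fine 'E_(P n)[f \o Y n]%E)); last first.
  by apply/funext => n /=; rewrite subKr.
by rewrite -[X in _ --> X]subr0; exact: cvgB.
Unshelve. all: by end_near. Qed.

End convergence.

(** * From filters to probabilities *)

Section good_events.
Context (R : realType) (d : nat -> measure_display).
Context (T : forall n, measurableType (d n)) (P : forall n, probability (T n) R).
Context (z D : forall n, T n -> R).

(** A property holds near this filter when, for large sample sizes, it holds
    pointwise on the event that [z] is at most [M] and [D] is small. *)
Definition good_filter (M : R) : set_system {n & T n} :=
  filter_from [set p : nat * R | 0 < p.2]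
    (fun p => [set s | [/\ (p.1 <= tag s)%N, z (tagged s) <= M & D (tagged s) < p.2]]).

Lemma good_filter_filter M : Filter (good_filter M).
Proof.
apply: filter_from_filter; first by exists (0%N, 1) => /=.
move=> [n1 e1] [n2 e2] /= e10 e20; exists (maxn n1 n2, Num.min e1 e2) => /=.
  by rewrite lt_min e10.
move=> s /= [+ zM +]; rewrite geq_max lt_min => /andP[n1s n2s] /andP[e1s e2s].
by split; split.
Qed.

Lemma good_filter_tag M : tag s @[s --> good_filter M] --> \oo.
Proof.
move=> A [n _ nA]; exists (n, 1) => //= s [ns _ _].
by apply: nA.
Qed.

Lemma good_filter_bound M : \forall s \near good_filter M, z (tagged s) <= M.
Proof. by exists (0%N, 1) => //= s []. Qed.

Lemma good_filter_small M (e : R) : 0 < e ->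
  \forall s \near good_filter M, D (tagged s) < e.
Proof. by move=> e0; exists (0%N, e) => //= s []. Qed.

Hypothesis mz : forall n, measurable_fun [set: T n] (@z n).
Hypothesis mD : forall n, measurable_fun [set: T n] (@D n).
Hypothesis z_tight : forall eta : R, 0 < eta -> exists M : R,
  \forall n \near \oo, (P n [set w | (M < z w)%R] <= eta%:E)%E.
Hypothesis D_cvg0 : forall e : R, 0 < e ->
  P n [set w | e <= D w] @[n --> \oo] --> 0%E.

(** [M] depends on [eta] only and not on the events, which is what a bound in
    probability by a constant requires. *)
Lemma good_filter_prob (eta : R) : 0 < eta -> exists M : R,
  forall B : forall n, set (T n), (forall n, measurable (B n)) ->
  (\forall s \near good_filter M, ~ B (tag s) (tagged s)) ->
  \forall n \near \oo, (P n (B n) <= eta%:E)%E.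
Proof.
move=> eta0; have eta2 : 0 < eta / 2 by rewrite divr_gt0.
have [M zM] := z_tight eta2; exists M => B mB [[n0 e] /= e0 good].
have De := cvg_prob0_le (D_cvg0 e0) eta2.
near=> n.
have zn : (P n [set w | (M < z w)%R] <= (eta / 2)%:E)%E by near: n.
have Dn : (P n [set w | (e <= D w)%R] <= (eta / 2)%:E)%E by near: n.
have n0n : (n0 <= n)%N by near: n; exact: nbhs_infty_ge.
have m1 : measurable [set w : T n | M < z w] by exact: measurable_gt_cst.
have m2 : measurable [set w : T n | e <= D w] by exact: measurable_ge_cst.
apply: (@le_trans _ _ (P n ([set w | (M < z w)%R] `|` [set w | (e <= D w)%R]))).
  rewrite le_measure ?inE//; first exact: measurableU.
  move=> w Bw; apply: contrapT => /not_orP[/negP zw /negP Dw].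
  apply: (good (existT _ n w)) Bw; split=> //=; first by rewrite leNgt.
  by rewrite ltNge.
by rewrite (le_trans (measureU2 _ m1 m2))// [eta]splitr EFinD leeD.
Unshelve. all: by end_near. Qed.

Lemma good_filter_cvg0 (X : forall n, T n -> R) :
  (forall n, measurable_fun [set: T n] (X n)) ->
  (forall M, X (tag s) (tagged s) @[s --> good_filter M] --> (0 : R)) ->
  forall e : R, 0 < e -> P n [set w | e <= `|X n w|] @[n --> \oo] --> 0%E.
Proof.
move=> mX X0 e e0.
have mB n : measurable [set w | e <= `|X n w|].
  exact: (measurable_ge_cst _ (measurableT_comp (@normr_measurable R setT) (mX n))).
apply: cvg_prob0 => // eta eta0.
have [M] := good_filter_prob eta0; apply=> //.
have e2 : 0 < e / 2 by rewrite divr_gt0.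
have := cvgr0_le (good_filter_filter M) (X0 M) e2.
have FF := good_filter_filter M.
apply: filterS => s /= Xs; apply/negP; rewrite -ltNge.
by apply: le_lt_trans Xs _; lra.
Qed.

Lemma good_filter_bigO (X : forall n, T n -> R) :
  (forall n, measurable_fun [set: T n] (X n)) ->
  (forall M, exists K : R, \forall s \near good_filter M, `|X (tag s) (tagged s)| <= K) ->
  bigO_in_prob1 P X.
Proof.
move=> mX XK eta eta0; have [M H] := good_filter_prob eta0.
have [K KX] := XK M; exists K; apply: H.
  move=> n.
  exact: (measurable_gt_cst _ (measurableT_comp (@normr_measurable R setT) (mX n))).
have FF := good_filter_filter M.
by apply: filterS KX => s; rewrite leNgt => /negP.
Qed.

End good_events.

(** * Continuity and measurability of the statistics *)

Section continuity.
Context (R : realType).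

Lemma continuous_mulmx_entry m n p (A : 'M[R]_(m, n)) i j :
  continuous (fun B : 'M[R]_(n, p) => (A *m B) i j).
Proof.
move=> B; have FF : Filter (nbhs B) by exact: nbhs_filter.
apply/cvgrPdist_le => e e0.
pose K := n%:R * `|A| + 1.
have K0 : 0 < K by rewrite ltr_wpDl// mulr_ge0.
have eK : 0 < e / K by rewrite divr_gt0.
near=> C.
have BC : `|B - C| <= e / K by near: C; apply: cvgr_dist_le eK; exact: cvg_id.
have -> : (A *m B) i j - (A *m C) i j = (A *m (B - C)) i j.
  by rewrite mulmxBr !mxE.
rewrite (le_trans (entry_le_mxnorm _ _ _))// (le_trans (mxnorm_mul _ _))//.
rewrite (@le_trans _ _ (K * `|B - C|))//.
  by rewrite ler_wpM2r// lerDl.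
by rewrite mulrC -ler_pdivlMr.
Unshelve. all: by end_near. Qed.

Lemma continuous_psi : continuous (fun th : 'cV[R]_(2 + 1) => dsubmx th 0 0).
Proof.
move=> th; rewrite [X in continuous_at _ X](_ : _ =
  fun th : 'cV[R]_(2 + 1) => th (rshift 2 0) 0).
  exact: coord_continuous.
by apply/funext => ?; rewrite mxE.
Qed.

Lemma continuous_qform_sub k (W : 'M[R]_k) (y : 'cV[R]_k) :
  continuous (fun v : 'cV[R]_k => qform W (y - v)).
Proof.
move=> v; have FF : Filter (nbhs v) by exact: nbhs_filter.
apply/subr_cvg0.
rewrite [X in X @ _ --> _](_ : _ = fun v' =>
    qform W ((y - v) - (v' - v)) - qform W (y - v)); last first.
  by apply/funext => v'; rewrite opprB addrA subrK.
apply: (@qform_perturbation _ _ _ FF _ W (fun=> W) (fun=> y - v) _ `|y - v|).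
- exact: cvg_cst.
- by near=> v'.
- by apply/subr_cvg0; exact: cvg_id.
Unshelve. all: by end_near. Qed.

End continuity.

Section measurability_of_infima.
Context (R : realType) dT (T : measurableType dT).

Lemma rat_approx k (v : 'cV[R]_k) (e : R) : 0 < e ->
  exists q : 'cV[rat]_k, `|v - map_mx ratr q| <= e.
Proof.
move=> e0.
have H i : exists q : rat, `|v i 0 - ratr q| <= e.
  have : v i 0 - e < v i 0 + e by lra.
  move=> /rat_in_itvoo[q]; rewrite in_itv/= => /andP[q1 q2].
  by exists q; apply/ler_normlP; split; lra.
exists (\col_i sval (cid (H i))).
apply: mxnorm_le; first exact: ltW.
by move=> i j; rewrite !mxE ord1; case: cid.
Qed.

(** Replacing the index set by a countable one: for each rational ball that
    meets the range of [m], one index whose image is in the ball suffices. *)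
Lemma measurable_exists_lt k (I : Type) (J : set I) (m : I -> 'cV[R]_k)
    (f : T -> 'cV[R]_k -> R) (a : R) :
  (forall v, measurable_fun [set: T] (f ^~ v)) ->
  (forall w, continuous (f w)) ->
  measurable [set w | exists2 i, J i & f w (m i) < a].
Proof.
move=> mf cf.
pose near_idx (p : 'cV[rat]_k * nat) (i : I) :=
  J i /\ `|m i - map_mx ratr p.1| <= p.2.+1%:R^-1.
pose idx p : option I :=
  if pselect (exists i, near_idx p i) is left e then Some (sval (cid e)) else None.
have idxP p i : idx p = Some i -> near_idx p i.
  by rewrite /idx; case: pselect => // e [<-]; exact: svalP.
pose A p : set T := if idx p is Some i then [set w | f w (m i) < a] else set0.
rewrite (_ : mkset _ = \bigcup_p A p).
  apply: countable_bigcupT_measurable; first exact: countableP.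
  move=> p; rewrite /A; case: (idx p) => [i|] //.
  by apply: measurable_lt_cst; exact: mf.
apply/seteqP; split=> w /=.
  move=> [i Ji fi].
  have [r /= r0 ball_r] : exists2 r : R, 0 < r &
      forall v, `|m i - v| < r -> f w v < a.
    have := cf w (m i) [set x | x < a] (lt_nbhsl fi).
    by move=> /nbhs_ballP[r r0 Hr]; exists r => // v vr; apply: Hr; rewrite -ball_normE.
  pose n := Num.truncn (2 / r).
  have n_r : n.+1%:R^-1 + n.+1%:R^-1 < r.
    have : 2 / r < n.+1%:R by exact: truncnS_gt.
    rewrite ltr_pdivrMr// => nr.
    rewrite -[X in X + X]mul1r -mulrDl ltr_pdivrMr ?ltr0Sn//.
    by rewrite mulrC.
  have n0 : 0 < n.+1%:R^-1 :> R by rewrite invr_gt0 ltr0Sn.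
  have [q qi] := rat_approx (m i) n0.
  have ex : exists i, near_idx (q, n) i by exists i.
  case Ei : (idx (q, n)) => [j|]; last first.
    by move: Ei; rewrite /idx; case: pselect.
  exists (q, n) => //; rewrite /A Ei /=; apply: ball_r.
  have [_ /= qj] := idxP _ _ Ei.
  rewrite -(subrKA (map_mx ratr q)) (le_lt_trans (ler_normD _ _))//.
  by rewrite distrC in qj; rewrite (le_lt_trans (lerD qi qj)).
move=> [p _]; rewrite /A; case Ei : (idx p) => [i|] //= fi.
by exists i => //; have [] := idxP _ _ Ei.
Qed.

Lemma measurable_inf k (I : Type) (J : set I) (m : I -> 'cV[R]_k)
    (f : T -> 'cV[R]_k -> R) :
  (exists i, J i) ->
  (forall w v, 0 <= f w v) ->
  (forall v, measurable_fun [set: T] (f ^~ v)) ->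
  (forall w, continuous (f w)) ->
  measurable_fun [set: T] (fun w => inf [set f w (m i) | i in J]).
Proof.
move=> [i0 Ji0] f0 mf cf.
apply: (measurability _ (RGenInftyO.measurableE R)) => //.
move=> _ [_ [x ->] <-]; rewrite setTI.
rewrite (_ : _ @^-1` _ = [set w | exists2 i, J i & f w (m i) < x]).
  exact: measurable_exists_lt.
apply/seteqP; split=> w /=; rewrite in_itv/=.
  move=> /inf_lt[|_ [i Ji <-] fi]; last by exists i.
  by exists (f w (m i0)); exists i0.
move=> [i Ji]; apply: le_lt_trans; apply: ge_inf; last by exists i.
by exists 0 => _ [j _ <-].
Qed.

Lemma measurable_qform k (y : T -> 'cV[R]_k) (W : T -> 'M[R]_k) v :
  random_element y -> random_element W ->
  measurable_fun [set: T] (fun w => qform (W w) (y w - v)).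
Proof.
move=> my mW.
have my' i : measurable_fun [set: T] (fun w => y w i 0 - v i 0).
  apply: measurable_funB => //.
  apply: (@random_element_real R _ T _ y (fun u : 'cV[R]_k => u i 0) _ my).
  exact: coord_continuous.
have mW' i j : measurable_fun [set: T] (fun w => W w i j).
  apply: (@random_element_real R _ T _ W (fun A : 'M[R]_k => A i j) _ mW).
  exact: coord_continuous.
rewrite (_ : (fun w => _) = fun w => \sum_j (\sum_i (y w i 0 - v i 0) * W w i j)
    * (y w j 0 - v j 0)); last first.
  apply/funext => w; rewrite /qform /bform mxE; apply: eq_bigr => j _.
  rewrite !mxE; congr (_ * _); apply: eq_bigr => i _.
  by rewrite !mxE.
apply: measurable_sum => j; apply: measurable_funM => //.
by apply: measurable_sum => i; exact: measurable_funM.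
Qed.

End measurability_of_infima.

Section infQ_facts.
Context (R : realType) (k : nat) (Theta : set 'cV[R]_(2 + 1)).
Context (mut : 'cV[R]_(2 + 1) -> 'cV[R]_k).

Lemma infQE y W : infQ Theta mut y W = inf [set qform W (y - mut th) | th in Theta].
Proof.
congr inf; apply/seteqP; split => q /=.
  by move=> [a [b [Tab ->]]]; exists (param a b).
move=> [th Tth <-]; exists (usubmx th), (dsubmx th 0 0).
by rewrite /Qcrit -paramE.
Qed.

Lemma infQ0E y W : infQ0 Theta mut y W =
  inf [set qform W (y - mut (param a 0)) | a in [set a | Theta (param a 0)]].
Proof.
congr inf; apply/seteqP; split => q /=.
  by move=> [a [Ta ->]]; exists a.
by move=> [a Ta <-]; exists a.
Qed.

Lemma infQ_le y W th : posdefmx W -> Theta th ->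
  infQ Theta mut y W <= qform W (y - mut th).
Proof.
move=> Wpd Tth; rewrite infQE; apply: ge_inf; last by exists th.
by exists 0 => _ [t _ <-]; exact: qform_ge0.
Qed.

Lemma infQ0_le y W a : posdefmx W -> Theta (param a 0) ->
  infQ0 Theta mut y W <= qform W (y - mut (param a 0)).
Proof.
move=> Wpd Ta; rewrite infQ0E; apply: ge_inf; last by exists a.
by exists 0 => _ [t _ <-]; exact: qform_ge0.
Qed.

Context dT (T : measurableType dT) (y : T -> 'cV[R]_k) (W : T -> 'M[R]_k).
Hypotheses (my : random_element y) (mW : random_element W).
Hypothesis Wpd : forall w, posdefmx (W w).

Lemma measurable_infQ a b : Theta (param a b) ->
  measurable_fun [set: T] (fun w => infQ Theta mut (y w) (W w)).
Proof.
move=> Tab; under eq_fun do rewrite infQE.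
apply: (@measurable_inf _ _ _ _ _ Theta mut (fun w v => qform (W w) (y w - v))).
- by exists (param a b).
- by move=> w v; exact: qform_ge0.
- by move=> v; exact: measurable_qform.
- by move=> w; exact: continuous_qform_sub.
Qed.

Lemma measurable_infQ0 a : Theta (param a 0) ->
  measurable_fun [set: T] (fun w => infQ0 Theta mut (y w) (W w)).
Proof.
move=> Ta; under eq_fun do rewrite infQ0E.
apply: (@measurable_inf _ _ _ _ _ _ (fun a => mut (param a 0))
  (fun w v => qform (W w) (y w - v))).
- by exists a.
- by move=> w v; exact: qform_ge0.
- by move=> v; exact: measurable_qform.
- by move=> w; exact: continuous_qform_sub.
Qed.

End infQ_facts.

Section measurability_of_norms.
Context (R : realType) dT (T : measurableType dT) (k : nat).
Context (X : T -> 'cV[R]_k) (c : 'cV[R]_k).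
Hypothesis mX : random_element X.

Lemma measurable_dist : measurable_fun [set: T] (fun w => `|X w - c|).
Proof.
apply: (@random_element_real R _ T _ X (fun u : 'cV[R]_k => `|u - c|) _ mX).
by move=> u; exact: cvg_norm (cvgB cvg_id (cvg_cst _)).
Qed.

Lemma measurable_enorm_dist : measurable_fun [set: T] (fun w => enorm (X w - c)).
Proof.
apply: measurableT_comp.
  by apply: continuous_measurable_fun; exact: sqrt_continuous.
apply: measurable_sum => i; apply: measurable_funX.
apply: (@random_element_real R _ T _ X (fun u : 'cV[R]_k => (u - c) i 0) _ mX).
move=> u; rewrite [X in continuous_at _ X](_ : _ = fun u : 'cV[R]_k => u i 0 - c i 0).
  exact: cvgB (@coord_continuous _ _ _ _ _ _) (cvg_cst _).
by apply/funext => v; rewrite !mxE.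
Qed.

End measurability_of_norms.

(** * Gaussian limit laws *)

Section laws.
Context (R : realType).
Local Notation N01 := (normal_prob (0 : R) 1).

Lemma normal_law01 : normal_law (0 : R) 1 = N01.
Proof. by rewrite /normal_law oner_eq0 sqrtr1. Qed.

Lemma expectation_has_law d (T : measurableType d) (P : probability T R)
    (X : T -> R) (f : R -> R) :
  has_law P X N01 -> measurable_fun [set: R] f -> bounded_fun f ->
  'E_P[f \o X]%E = 'E_N01[f]%E.
Proof.
move=> [mX XN] mf /bounded_funP[B B0 fB].
have ifX : P.-integrable [set: T] ((EFin \o f) \o X).
  apply: (@bounded_integrable _ _ _ _ (f \o X) B) => //.
    exact: measurableT_comp.
  by move=> w; exact: fB.
(* [normal_prob] lives on the measurable type generated by intervals, which has
   the measurable sets of the real line but another display; [X] is retyped. *)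
have mX' : measurable_fun [set: T] (X : T -> measurableTypeR R) := mX.
have mf' : measurable_fun [set: measurableTypeR R] (EFin \o f).
  exact/measurable_EFinP.
rewrite unlock.
have := integral_pushforward mX' mf' ifX measurableT.
rewrite preimage_setT => /= <-.
pose Xm : {mfun T >-> measurableTypeR R} :=
  HB.pack (X : T -> measurableTypeR R) (isMeasurableFun.Build _ _ _ _ _ mX').
have H := @eq_measure_integral _ _ R setT N01 (distribution P Xm) (EFin \o f).
by apply: H => A mA _; exact: XN.
Qed.

Lemma measurable_sqr_preimage (A : set R) : measurable A ->
  measurable [set x : R | A (x ^+ 2)].
Proof.
move=> mA; have mf : measurable_fun [set: R] (fun x : R => x ^+ 2).
  by apply: measurable_funX.
by have := mf measurableT A mA; rewrite setTI.
Qed.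

(** The positive half of a symmetric law without atom at the origin carries half
    of the law of the square, and the negative half is sent to the origin. *)
Lemma has_law_max0_sqr :
  (forall A : set R, measurable A -> N01 [set x : R | A (- x)] = N01 A) ->
  has_law N01 (fun x : R => Num.max 0 x ^+ 2) (@half_chisq01 R).
Proof.
move=> Nsym.
have mmax : measurable_fun [set: R] (fun x : R => Num.max 0 x ^+ 2).
  apply: measurable_funX; apply: measurable_maxr => //.
split=> // A mA.
pose neg : set R := [set x | x < 0]; pose pos : set R := [set x | 0 < x].
have mneg : measurable neg by rewrite /neg -set_itvNyo; exact: measurable_itv.
have mpos : measurable pos by rewrite /pos -set_itvoy; exact: measurable_itv.
have N0 : N01 [set 0] = 0%E.
  have /null_content_dominatesP := @normal_prob_dominates R 0 1; apply.
    exact: measurable_set1.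
  exact: lebesgue_measure_set1.
pose sq (B : set R) : set R := [set x : R | B (x ^+ 2)].
have half (B : set R) : measurable B ->
    N01 (sq B) = (N01 (sq B `&` pos) +
      N01 (sq B `&` pos))%E.
  move=> mB; set C := sq B.
  have mC : measurable C by exact: measurable_sqr_preimage.
  have -> : N01 C = N01 ((C `&` neg `|` C `&` pos) `|` C `&` [set 0]).
    congr N01; rewrite -!setIUr [X in C `&` X](_ : _ = setT) ?setIT//.
    apply/seteqP; split => // x _ /=.
    by have [x0|x0|->] := ltgtP x 0; [left; left|left; right|right].
  have mCn : measurable (C `&` neg) by exact: measurableI.
  have mCp : measurable (C `&` pos) by exact: measurableI.
  have mC0 : measurable (C `&` [set 0]) by exact: measurableI.
  have NC0 : N01 (C `&` [set 0]) = 0%E.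
    apply/eqP; rewrite eq_le measure_ge0 andbT -N0 le_measure ?inE//.
  rewrite measureU0; [|exact: (measurableU _ _ mCn mCp)|exact: mC0|exact: NC0].
  rewrite measureU; [|exact: mCn|exact: mCp|]; last first.
    apply/seteqP; split => // x /= [[_ x1] [_ x2]].
    by have := lt_trans x1 x2; rewrite ltxx.
  congr (_ + _)%E; rewrite -[LHS]Nsym; last exact: measurableI.
  congr N01; apply/seteqP; split=> x /=; rewrite /C /sq /neg /pos /= sqrrN oppr_lt0.
    by [].
  by [].
have fin B : measurable B -> N01 B \is a fin_num by move=> mB; exact: fin_num_measure.
have Npos : N01 pos = (2^-1)%:E.
  have := half setT measurableT; rewrite [X in N01 X = _](_ : _ = setT)//.
  rewrite probability_setT [X in N01 X](_ : _ = pos); last first.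
    by apply/seteqP; split => x //= [].
  rewrite -(fineK (fin _ mpos)) -EFinD => -[] h; congr (_%:E); lra.
have Nneg : N01 (~` pos) = (2^-1)%:E.
  transitivity (1 - N01 pos)%E; first exact: probability_setC.
  by rewrite Npos -EFinB; congr (_%:E); lra.
have mApos : measurable (sq A `&` pos).
  by apply: measurableI => //; exact: measurable_sqr_preimage.
rewrite /half_chisq01 /chisq1 /chisq0 /pushforward.
rewrite [X in (_ + (2^-1)%:E * N01 X)%E](_ : _ = sq A)//.
rewrite (half A mA) -(fineK (fin _ mApos)) diracE; set p := fine _.
have -> : ((2^-1)%:E * (p%:E + p%:E) = p%:E)%E.
  by rewrite -EFinD -EFinM; congr (_%:E); lra.
have -> : (fun x : R => Num.max 0 x ^+ 2) @^-1` A = (sq A `&` pos) `|`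
    (if (0 : R) \in A then ~` pos else set0).
  apply/seteqP; split => x /=.
    have [x0|x0] := leP x 0.
      rewrite expr0n/= => A0; right.
      by rewrite mem_set// /pos /=; apply/negP; rewrite -leNgt.
    by move=> Ax; left; split.
  case=> [[Ax x0]|]; first by rewrite max_r// ltW.
  case: ifPn => //; rewrite inE => A0 /negP; rewrite -leNgt => x0.
  by rewrite max_l// expr0n.
rewrite measureU//; last 2 first.
  by case: ifP => // _; exact: measurableC.
  by case: ifP => // _; [rewrite -setIA setICr setI0|rewrite setI0].
rewrite -[X in (X + _)%E = _](fineK (fin _ mApos)) -/p addeC.
case: ifP => _ /=; first by rewrite Nneg mule1.
by rewrite measure0 mule0.
Qed.

End laws.

Section limit_laws.
Context (R : realType) (k : nat) (Omega : 'M[R]_k) (G : 'M[R]_(k, 2 + 1)).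
Local Notation V := (invmx Omega).
Local Notation I := (Ieff Omega G).
Local Notation N01 := (normal_prob (0 : R) 1).

Hypothesis Omega_pd : posdefmx Omega.
Hypothesis I_gt0 : 0 < I.

Context (d' : measure_display) (T' : measurableType d') (P' : probability T' R).
Context (Z : T' -> 'cV[R]_k).
Hypothesis Z_normal : normal_vector P' Z 0 Omega.

Lemma Delta_law (c : R) :
  has_law P' (fun w => c * Delta Omega G (Z w)) (normal_law 0 (c ^+ 2 * I)).
Proof.
have VT : V^T = V by case: (posdefmx_inv Omega_pd).
have Ou := posdefmx_unit Omega_pd.
have := Z_normal (c *: (V *m rpsi Omega G)).
rewrite mulmx0 mxE.
have -> : ((c *: (V *m rpsi Omega G))^T *m Omega *m (c *: (V *m rpsi Omega G))) 0 0
    = c ^+ 2 * I.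
  rewrite -[LHS]/(qform Omega _) qformZ; congr (_ * _).
  by rewrite /qform /bform trmx_mul VT -!mulmxA mulKVmx// mulmxA.
congr has_law; apply/funext => w.
by rewrite [(_ *: _)^T]linearZ/= -scalemxAl mxE trmx_mul VT.
Qed.

Lemma standardized_Delta_law (c : R) : c ^+ 2 = I^-1 ->
  has_law P' (fun w => c * Delta Omega G (Z w)) N01.
Proof.
by move=> cI; rewrite -normal_law01 -(mulVf (lt0r_neq0 I_gt0)) -cI; exact: Delta_law.
Qed.

(** The symmetry of the standard normal law is read off the Gaussian vector:
    [Delta] and its opposite, once standardized, both follow this law. *)
Lemma normal01_sym (A : set R) : measurable A -> N01 [set x : R | A (- x)] = N01 A.
Proof.
move=> mA; pose c := Num.sqrt I^-1.
have cI : c ^+ 2 = I^-1 by rewrite sqr_sqrtr// invr_ge0 ltW.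
have [_ lawp] := standardized_Delta_law cI.
have [_ lawn] : has_law P' (fun w => - c * Delta Omega G (Z w)) N01.
  by apply: standardized_Delta_law; rewrite sqrrN.
have mA' : measurable [set x : R | A (- x)].
  have mopp : measurable_fun [set: R] (fun x : R => - x) by exact: oppr_measurable.
  by have := mopp measurableT A mA; rewrite setTI.
rewrite -lawp// -lawn//; congr (P' _).
by apply/seteqP; split => w /=; rewrite mulNr.
Qed.

Lemma bstar_sqr_standardized z :
  I * bstar Omega G z ^+ 2 = Num.max 0 (Num.sqrt I^-1 * Delta Omega G z) ^+ 2.
Proof.
have c0 : 0 < Num.sqrt I^-1 by rewrite sqrtr_gt0 invr_gt0.
have cI : Num.sqrt I^-1 ^+ 2 = I^-1 by rewrite sqr_sqrtr// invr_ge0 ltW.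
rewrite /bstar; have [D0|D0] := leP 0 (Delta Omega G z).
  rewrite !max_r ?divr_ge0 ?mulr_ge0 ?(ltW I_gt0) ?(ltW c0)//.
  by rewrite [RHS]exprMn cI; field; rewrite gt_eqF.
rewrite !max_l ?expr0n ?mulr0//.
  by rewrite ltW// pmulr_rlt0.
by rewrite ltW// pmulr_llt0// invr_gt0.
Qed.

Lemma continuous_bstar : continuous (bstar Omega G).
Proof.
apply: continuous_max0 => z.
exact: cvgM (@continuous_mulmx_entry R 1 k 1 _ 0 0 z) (cvg_cst _).
Qed.

(** Only the law of the limit matters, so that it may be realized on the real
    line itself. *)
Lemma cvg_in_law_standard_normal (d : nat -> measure_display)
    (T : forall n, measurableType (d n)) (P : forall n, probability (T n) R)
    (X : forall n, T n -> R) (X' xi : T' -> R) (g : R -> R) :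
  continuous g -> has_law P' xi N01 -> (forall w, X' w = g (xi w)) ->
  cvg_in_law P X P' X' -> cvg_in_law P X N01 g.
Proof.
move=> cg xiN X'E [mX mX' XX']; split=> // [|f cf fb].
  apply/random_elementP => A oA; apply: open_measurable.
  by move/continuousP : cg; apply.
have := XX' f cf fb.
have -> : f \o X' = (f \o g) \o xi by apply/funext => w /=; rewrite X'E.
rewrite expectation_has_law//.
  apply: continuous_measurable_fun => x.
  by apply: continuous_comp; [exact: cg|exact: cf].
have [B B0 fB] := bounded_funP fb.
by apply: (@bounded_fun_le _ _ _ B) => x; exact: fB.
Qed.

End limit_laws.

(** * Asymptotics of the estimators at the boundary *)

Lemma quartic_root_scaling (R : realType) (n : nat) (x : R) :
  n%:R `^ 4^-1 * Num.sqrt x = Num.sqrt (Num.sqrt (n%:R : R) * x).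
Proof.
rewrite sqrtrM ?sqrtr_ge0//; congr (_ * _).
rewrite -!powR12_sqrt ?sqrtr_ge0// -powRrM; congr (_ `^ _).
by rewrite -invfM; congr (_^-1); rewrite -natrM.
Qed.

Theorem theoremS4p6 (R : realType)
  (* probability spaces carrying the n-th sample *)
  (d : nat -> measure_display) (T : forall n, measurableType (d n))
  (P : forall n, probability (T n) R)
  (* probability space carrying the Gaussian limit *)
  (d' : measure_display) (T' : measurableType d') (P' : probability T' R)
  (Z : T' -> 'cV[R]_5)
  (alpha0 : 'cV[R]_2) (Theta : set 'cV[R]_(2 + 1))
  (Y : forall n, T n -> 'cV[R]_5) (W : forall n, T n -> 'M[R]_5)
  (mun mutn : nat -> 'cV[R]_(2 + 1) -> 'cV[R]_5)
  (mu : 'cV[R]_(2 + 1) -> 'cV[R]_5)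
  (G : 'M[R]_(5, 2 + 1)) (Omega : 'M[R]_5)
  (ahat : forall n, T n -> 'cV[R]_2) (psihat : forall n, T n -> R)
  (ahat0 : forall n, T n -> 'cV[R]_2)
  (r1 r0 : forall n, T n -> R) :
  let thetab := param alpha0 0 in
  let thetahat := fun n (w : T n) => param (ahat n w) (psihat n w) in
  let thetahat0 := fun n (w : T n) => param (ahat0 n w) 0 in
  let sqrtn := fun n : nat => Num.sqrt (n%:R : R) : R in
  let Q := fun n (w : T n) => Qcrit (mutn n) (Y n w) (W n w) in
  let infQn := fun n (w : T n) => infQ Theta (mutn n) (Y n w) (W n w) in
  let infQ0n := fun n (w : T n) => infQ0 Theta (mutn n) (Y n w) (W n w) in
  let I := Ieff Omega G in
  let DeltaZ := fun w : T' => Delta Omega G (Z w) in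
  (* parameter set *)
  compact Theta ->
  Theta `<=` cone R ->
  (exists rho : R, 0 < rho /\
    forall h, cone R h -> enorm h < rho -> Theta (thetab + h)) ->
  (* data *)
  (forall n, random_element (Y n)) ->
  (forall n, random_element (W n)) ->
  (* (B1) *)
  posdefmx Omega ->
  normal_vector P' Z 0 Omega ->
  cvg_in_law P (fun n w => sqrtn n *: (Y n w - mun n thetab)) P' Z ->
  cvg_in_prob P W (invmx Omega) ->
  (forall n w, posdefmx (W n w)) ->
  (* (B2) *)
  ereal_sup [set (enorm (mun n th - mu th))%:E | th in Theta]
    @[n --> \oo] --> 0%E ->
  {within Theta, continuous mu} ->
  (forall th, Theta th -> mu th = mu thetab -> th = thetab) ->
  (* (B3) *)
  limn_esup (fun n => ereal_sup
      [set (enorm (mun n th - mun n thetab - G *m (th - thetab))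
              / enorm (th - thetab))%:E
        | th in [set th | Theta th /\ 0 < enorm (th - thetab) <= r]])
    @[r --> (0 : R)^'+] --> 0%E ->
  ((sqrtn n)%:E * ereal_sup [set (enorm (mutn n th - mun n th))%:E | th in Theta])%E
    @[n --> \oo] --> 0%E ->
  (* (B4) *)
  \rank (Galpha G) = 2%N ->
  0 < I ->
  (* estimators *)
  (forall n, random_element (thetahat n)) ->
  (forall n, random_element (thetahat0 n)) ->
  (forall n w, Theta (thetahat n w)) ->
  (forall n w, Theta (thetahat0 n w)) ->
  (forall n, random_element (r1 n)) ->
  (forall n, random_element (r0 n)) ->
  (forall n w, 0 <= r1 n w) ->
  (forall n w, 0 <= r0 n w) ->
  cvg_in_prob P (fun n w => n%:R * (r1 n w + r0 n w)) 0 ->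
  (forall n w, Q n w (ahat n w) (psihat n w) <= infQn n w + r1 n w) ->
  (forall n w, Q n w (ahat0 n w) 0 <= infQ0n n w + r0 n w) ->
  (* consistency *)
  (cvg_in_prob P thetahat thetab /\ cvg_in_prob P thetahat0 thetab) /\
  (* root-n localization *)
  (bigO_in_prob1 P (fun n w => sqrtn n * enorm (thetahat n w - thetab)) /\
   bigO_in_prob1 P (fun n w => sqrtn n * enorm (thetahat0 n w - thetab))) /\
  (* limit law of psihat *)
  (has_law P' DeltaZ (normal_law 0 I) /\
   cvg_in_law P (fun n w => sqrtn n * psihat n w)
     P' (fun w => Num.max 0 (DeltaZ w / I))) /\
  (* limit law of bhat *)
  cvg_in_law P (fun n w => n%:R `^ 4^-1 * Num.sqrt (psihat n w))
    P' (fun w => Num.sqrt (Num.max 0 (DeltaZ w / I))) /\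
  (* limit law of D_n *)
  (cvg_in_law P (fun n w => n%:R * (infQ0n n w - infQn n w))
     (normal_prob (0 : R) 1) (fun x : R => Num.max 0 x ^+ 2) /\
   has_law (normal_prob (0 : R) 1) (fun x : R => Num.max 0 x ^+ 2)
     (@half_chisq01 R)).
Proof.
move=> thetab thetahat thetahat0 sqrtn Q infQn infQ0n I DeltaZ.
move=> Theta_compact Theta_cone [rho [rho0 Theta_rho]] mY mW Omega_pd Z_normal
  Zn_cvg W_cvg W_pd mun_mu0 mu_cont mu_id lin0 mutn0 Ga_rank I_gt0 mth mth0
  thT th0T mr1 mr0 r1_ge0 r0_ge0 rho_cvg th_min th0_min.
have sqrtn0 n : 0 <= sqrtn n by exact: sqrtr_ge0.
have Theta_local : exists2 rho : R, 0 < rho &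
    forall h, cone R h -> `|h| < rho -> Theta (thetab + h).
  (* The Euclidean norm is at most 3 times the sup norm in dimension 3. *)
  exists (rho / 4) => [|h hc hr]; first by rewrite divr_gt0.
  apply: Theta_rho => //; apply: le_lt_trans (enorm_le_mxnorm h) _.
  by have := normr_ge0 h; lra.
have Tb : Theta thetab := thetab_Theta Theta_local.
have mun_mu (e : R) : 0 < e ->
    \forall n \near \oo, forall th, Theta th -> `|mun n th - mu th| <= e.
  move=> e0.
  have := @sup_cvg0_near R _ Theta (fun=> 1) (fun n th => mun n th - mu th) _ _ e e0.
  under eq_fun do rewrite mul1e.
  move=> /(_ (fun=> ler01) mun_mu0); apply: filterS => n H th Tth.
  by have := H th Tth; rewrite mul1r.
have mun_G := linearization_near lin0.
have mutn_mun := sup_cvg0_near sqrtn0 mutn0.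
have mu_sep := identified_separated Theta_compact mu_cont mu_id.
pose Zn n w := sqrtn n *: (Y n w - mun n thetab).
pose z n w := `|Zn n w|.
pose dW n w := `|W n w - invmx Omega|.
pose dr n w := `|n%:R * (r1 n w + r0 n w)|.
pose D n w := Num.max (dW n w) (dr n w).
have mZn n : random_element (Zn n) by have [] := Zn_cvg.
have mz n : measurable_fun [set: T n] (z n).
  by apply: (random_element_real _ (mZn n)); exact: norm_continuous.
have mdW n : measurable_fun [set: T n] (dW n).
  apply: (@random_element_real R _ _ _ (W n) (fun A => `|A - invmx Omega|) _ (mW n)).
  by move=> A; exact: cvg_norm (cvgB cvg_id (cvg_cst _)).
have mr n : measurable_fun [set: T n] (fun w => n%:R * (r1 n w + r0 n w)).
  apply: measurable_funM => //; apply: measurable_funD; exact/random_element_measurable.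
have mdr n : measurable_fun [set: T n] (dr n).
  by apply: measurableT_comp (mr n); exact: normr_measurable.
have mD n : measurable_fun [set: T n] (D n) by exact: measurable_maxr.
have z_tight (eta : R) : 0 < eta -> exists M : R,
    \forall n \near \oo, (P n [set w | (M < z n w)%R] <= eta%:E)%E.
  move=> eta0.
  have [M H] := cvg_in_law_tight (cvg_in_law_comp (@norm_continuous R _) Zn_cvg) eta0.
  exists M; apply: filterS H => n.
  by under eq_set do rewrite normr_id.
have D_cvg0 (e : R) : 0 < e -> P n [set w | e <= D n w] @[n --> \oo] --> 0%E.
  move=> e0; apply: cvg_prob0 => [n|eta eta0]; first exact: measurable_ge_cst.
  have eta2 : 0 < eta / 2 by rewrite divr_gt0.
  have We := cvg_prob0_le (W_cvg e e0) eta2.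
  have re := cvg_prob0_le (rho_cvg e e0) eta2.
  near=> n.
  have Wn : (P n [set w | (e <= dW n w)%R] <= (eta / 2)%:E)%E by near: n.
  have rn : (P n [set w | (e <= dr n w)%R] <= (eta / 2)%:E)%E.
    rewrite (_ : mkset _ = [set w | e <= `|n%:R * (r1 n w + r0 n w) - 0|]).
      by near: n.
    by apply/seteqP; split => w /=; rewrite subr0.
  have m1 : measurable [set w | e <= dW n w] by exact: measurable_ge_cst.
  have m2 : measurable [set w | e <= dr n w] by exact: measurable_ge_cst.
  rewrite (_ : mkset _ = [set w | e <= dW n w] `|` [set w | e <= dr n w]).
    by rewrite (le_trans (measureU2 _ m1 m2))// [eta]splitr EFinD leeD.
  apply/seteqP; split => w /=; rewrite /D le_max; first by move/orP.
  by move=> ?; apply/orP.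
pose b := bstar Omega G.
have expansion M :
  [/\ (thetahat (tag s) (tagged s) @[s --> good_filter z D M] --> thetab /\
        exists K : R, \forall s \near good_filter z D M,
          `|sqrtn (tag s) *: (thetahat (tag s) (tagged s) - thetab)| <= K),
      (thetahat0 (tag s) (tagged s) @[s --> good_filter z D M] --> thetab /\
        exists K : R, \forall s \near good_filter z D M,
          `|sqrtn (tag s) *: (thetahat0 (tag s) (tagged s) - thetab)| <= K),
      sqrtn (tag s) * psihat (tag s) (tagged s) - b (Zn (tag s) (tagged s))
        @[s --> good_filter z D M] --> (0 : R) &
      (tag s)%:R * (infQ0n (tag s) (tagged s) - infQn (tag s) (tagged s))
        - I * b (Zn (tag s) (tagged s)) ^+ 2
        @[s --> good_filter z D M] --> (0 : R)].
  have FF := good_filter_filter z D M.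
  have := @near_minimizer_expansion R _ Omega G Omega_pd Ga_rank I_gt0 Theta alpha0
    mun mutn mu Theta_cone Theta_local mun_mu mun_G mutn_mun mu_sep
    {n & T n} (good_filter z D M) FF (fun s => tag s) (fun s => Y (tag s) (tagged s))
    (fun s => W (tag s) (tagged s)) M (@good_filter_tag _ _ _ z D M)
    (@good_filter_bound _ _ _ z D M) _
    (fun s => thetahat (tag s) (tagged s)) (fun s => thetahat0 (tag s) (tagged s))
    (fun s => infQn (tag s) (tagged s)) (fun s => infQ0n (tag s) (tagged s))
    (fun s => r1 (tag s) (tagged s) + r0 (tag s) (tagged s)).
  have small (e : R) : 0 < e -> \forall s \near good_filter z D M,
      dW (tag s) (tagged s) < e /\ dr (tag s) (tagged s) < e.
    move=> e0; apply: filterS (good_filter_small z D M e0) => s.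
    by rewrite /D gt_max => /andP.
  have -> : (fun s : {n & T n} =>
      sqrtn (tag s) * psihat (tag s) (tagged s) - b (Zn (tag s) (tagged s))) =
    (fun s => sqrtn (tag s) * dsubmx (thetahat (tag s) (tagged s)) 0 0
      - b (Zn (tag s) (tagged s))).
    by apply/funext => s; rewrite param_psi.
  apply.
  - apply/cvgrPdist_le => e e0; apply: filterS (small e e0) => s [+ _].
    by rewrite /dW distrC => /ltW.
  - by move=> s; exact: thT.
  - by move=> s; exact: th0T.
  - by move=> s; exact: param_psi.
  - by move=> s t Tt; rewrite /crit ler_wpM2l//; exact: infQ_le.
  - by move=> s a Ta; rewrite /crit ler_wpM2l//; exact: infQ0_le.
  - move=> s; rewrite -mulrDr /crit ler_wpM2l//.
    apply: le_trans (th_min _ _) _; rewrite lerD2l lerDl; exact: r0_ge0.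
  - move=> s; rewrite -mulrDr /crit ler_wpM2l//.
    apply: le_trans (th0_min _ _) _; rewrite lerD2l lerDr; exact: r1_ge0.
  - apply/cvgr0Pnorm_le => e e0; apply: filterS (small e e0) => s [_].
    by rewrite /dr => /ltW.
have consistent (th : forall n, T n -> 'cV[R]_(2 + 1)) :
    (forall n, random_element (th n)) ->
    (forall M, th (tag s) (tagged s) @[s --> good_filter z D M] --> thetab) ->
    cvg_in_prob P th thetab.
  move=> mt tb e e0.
  have mX n : measurable_fun [set: T n] (fun w => `|th n w - thetab|).
    exact: measurable_dist.
  have -> : (fun n => P n [set w | e <= `|th n w - thetab|]) =
      (fun n => P n [set w | e <= `| `|th n w - thetab| |]).
    by apply/funext => n; under [in RHS]eq_set do rewrite normr_id.
  apply: (good_filter_cvg0 mz mD z_tight D_cvg0 mX _ e0) => M.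
  have FF := good_filter_filter z D M.
  apply/cvgr0Pnorm_le => e1 e10.
  have /cvgrPdist_le/(_ _ e10) := tb M.
  by apply: filterS => s; rewrite normr_id distrC.
have localized (th : forall n, T n -> 'cV[R]_(2 + 1)) :
    (forall n, random_element (th n)) ->
    (forall M, exists K : R, \forall s \near good_filter z D M,
      `|sqrtn (tag s) *: (th (tag s) (tagged s) - thetab)| <= K) ->
    bigO_in_prob1 P (fun n w => sqrtn n * enorm (th n w - thetab)).
  move=> mt tK.
  apply: (good_filter_bigO mz mD z_tight D_cvg0).
    by move=> n; apply: measurable_funM => //; exact: measurable_enorm_dist.
  move=> M; have [K KX] := tK M; exists ((2 + 1)%:R * K).
  have FF := good_filter_filter z D M.
  apply: filterS KX => s.
  rewrite normrZ !ger0_norm ?mulr_ge0 ?sqrtr_ge0// => sK.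
  apply: le_trans (ler_wpM2l (sqrtn0 _) (enorm_le_mxnorm _)) _.
  by rewrite mulrCA ler_wpM2l.
have b_cvg : cvg_in_law P (fun n w => b (Zn n w)) P' (fun w => b (Z w)).
  exact: (cvg_in_law_comp (@continuous_bstar R 5 Omega G) Zn_cvg).
have mb n : measurable_fun [set: T n] (fun w => b (Zn n w)).
  by apply: (random_element_real _ (mZn n)); exact: continuous_bstar.
have mpsi n : measurable_fun [set: T n] (psihat n).
  have := random_element_real (@continuous_psi R) (mth n).
  by apply: eq_measurable_fun => w _; exact: param_psi.
have mspsi n : measurable_fun [set: T n] (fun w => sqrtn n * psihat n w).
  exact: measurable_funM.
have psi_law : cvg_in_law P (fun n w => sqrtn n * psihat n w) P'
    (fun w => Num.max 0 (DeltaZ w / I)).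
  apply: (cvg_in_law_slutsky b_cvg) => [n|e e0].
    exact/random_element_measurable.
  apply: (good_filter_cvg0 mz mD z_tight D_cvg0 _ _ e0).
    by move=> n; exact: measurable_funB.
  by move=> M; have [] := expansion M.
have sqr_cont (c : R) : continuous (fun x : R => c * x ^+ 2).
  by move=> x; apply: cvgM; [exact: cvg_cst|exact: exprn_continuous].
have mDn n : measurable_fun [set: T n] (fun w => n%:R * (infQ0n n w - infQn n w)).
  apply: measurable_funM => //; apply: measurable_funB.
    exact: (measurable_infQ0 _ (mY n) (mW n) (W_pd n) Tb).
  exact: (measurable_infQ _ (mY n) (mW n) (W_pd n) Tb).
have D_law : cvg_in_law P (fun n w => n%:R * (infQ0n n w - infQn n w)) P'
    (fun w => I * b (Z w) ^+ 2).
  apply: (cvg_in_law_slutsky (cvg_in_law_comp (sqr_cont I) b_cvg)) => [n|e e0].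
    exact/random_element_measurable.
  apply: (good_filter_cvg0 mz mD z_tight D_cvg0 _ _ e0).
    move=> n; apply: measurable_funB => //.
    by apply: measurable_funM => //; exact: measurable_funX.
  by move=> M; have [] := expansion M.
split; [split|split; [split|split; [split|split; [|split]]]].
- by apply: consistent => // M; have [[]] := expansion M.
- by apply: consistent => // M; have [_ []] := expansion M.
- by apply: localized => // M; have [[]] := expansion M.
- by apply: localized => // M; have [_ []] := expansion M.
- have := Delta_law G Omega_pd Z_normal 1.
  by rewrite expr1n mul1r; under eq_fun do rewrite mul1r.
- exact: psi_law.
- apply: cvg_in_law_ext (cvg_in_law_comp (@sqrt_continuous R) psi_law) => n w.
  by rewrite quartic_root_scaling.
- have cI : Num.sqrt I^-1 ^+ 2 = I^-1 by rewrite sqr_sqrtr// invr_ge0 ltW.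
  apply: (cvg_in_law_standard_normal _
    (standardized_Delta_law Omega_pd I_gt0 Z_normal cI) _ D_law).
    have max_cont : continuous (fun x : R => Num.max 0 x).
      by apply: continuous_max0 => y; exact: cvg_id.
    by move=> x; exact: cvgM (max_cont x) (max_cont x).
  by move=> w; exact: bstar_sqr_standardized.
- apply: has_law_max0_sqr => A mA.
  exact: (normal01_sym Omega_pd I_gt0 Z_normal mA).
Unshelve. all: by end_near. Qed.
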